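(* Let $k$ be a commutative ring with unit, $H$ a Hopf algebra over $k$ with a bijective antipode $S$ and projective over $k$, $A$ an $H$-bicomodule algebra and $B=A^{\mathrm{co}(H)}$ the subalgebra of quantum coinvariants of $A$. Assume that: 1. there exists a total quantum integral $\gamma:H\to\mathrm{Hom}(H,A)$; 2. the canonical map $\beta:A\otimes_B A\to H\otimes A$, $\beta(a\otimes_B b)=\sum S^{-1}(b_{<1>})b_{<-1>}\otimes ab_{<0>}$, is surjective. Then the induction functor $-\otimes_B A:\mathcal{M}_B\to{}^H\mathcal{YD}_A$ is an equivalence of categories.
   Context: Unadorned $\otimes$ and $\mathrm{Hom}$ are over $k$; $\Delta(h)=\sum h_{(1)}\otimes h_{(2)}$. An $H$-bicomodule algebra $A$ is an algebra that is an $H$-bicomodule whose coactions $\rho^l:A\to H\otimes A$, $\rho^l(a)=\sum a_{<-1>}\otimes a_{<0>}$, and $\rho^r:A\to A\otimes H$, $\rho^r(a)=\sum a_{<0>}\otimes a_{<1>}$, are algebra maps; $\sum a_{<-1>}\otimes a_{<0>}\otimes a_{<1>}$ denotes $(\rho^l\otimes\mathrm{Id})\rho^r(a)=(\mathrm{Id}\otimes\rho^r)\rho^l(a)$. ${}^H\mathcal{YD}_A$ is the category of quantum Yetter-Drinfel'd modules: objects are $k$-modules $M$ that are right $A$-modules and left $H$-comodules (coaction $\rho_M(m)=\sum m_{<-1>}\otimes m_{<0>}$) with $\rho_M(ma)=\sum S^{-1}(a_{<1>})m_{<-1>}a_{<-1>}\otimes m_{<0>}a_{<0>}$ for all $m\in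 M$, $a\in A$; morphisms are $A$-linear, $H$-colinear maps. The Verma structure on $A$ is the object of ${}^H\mathcal{YD}_A$ given by right multiplication and the coaction $\tilde\rho:A\to H\otimes A$, $\tilde\rho(a)=\sum S^{-1}(a_{<1>})a_{<-1>}\otimes a_{<0>}$. The subalgebra of quantum coinvariants is $B=A^{\mathrm{co}(H)}=\{a\in A\mid\tilde\rho(a)=1_H\otimes a\}$. $\mathcal{M}_B$ is the category of right $B$-modules. The induction functor sends $N\in\mathcal{M}_B$ to $N\otimes_B A$ with $(n\otimes_B a)a'=n\otimes_B aa'$ and coaction $n\otimes_B a\mapsto\sum S^{-1}(a_{<1>})a_{<-1>}\otimes n\otimes_B a_{<0>}$. A quantum integral is a $k$-linear map $\gamma:H\to\mathrm{Hom}(H,A)$ such that for all $g,h\in H$ $$\sum g_{(1)}\otimes\gamma(g_{(2)})(h)=\sum S^{-1}\bigl(\{\gamma(g)(h_{(1)})\}_{<1>}\bigr)h_{(2)}\{\gamma(g)(h_{(1)})\}_{<-1>}\otimes\{\gamma(g)(h_{(1)})\}_{<0>};$$ it is total if $\sum\gamma(h_{(1)})(h_{(2)})=\varepsilon(h)1_A$ for all $h\in H$. *)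

(* Defs.v *)
From HB Require Import structures.
From mathcomp Require Import all_boot all_algebra.
From mathcomp Require Import boolp.

Set Implicit Arguments.
Unset Strict Implicit.
Unset Printing Implicit Defensive.

Import GRing.Theory.
Local Open Scope ring_scope.
Local Open Scope quotient_scope.

Reserved Notation "M \otimes N" (at level 40, left associativity).
Reserved Notation "x \ox y" (at level 40, left associativity).
Reserved Notation "\tsum_ ( x & y <- t ) E"
  (at level 41, x name, y name, E at level 41,
   format "\tsum_ ( x  &  y  <-  t )  E").

(* Modules over a k-algebra R carry their k-module structure explicitly; it is
   the one induced by R, see [ract_scalar] and [lact_scalar]. *)
Record rmod (k : comNzRingType) (R : algType k) := RMod {
  rmod_car :> lmodType k;
  ract : rmod_car -> R -> rmod_car;
  ract_linl : forall r, linear (fun m => ract m r);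
  ract_linr : forall m, linear (fun r => ract m r);
  ract1 : forall m, ract m 1 = m;
  ractA : forall m r s, ract m (r * s) = ract (ract m r) s }.

Record lmod (k : comNzRingType) (R : algType k) := LMod {
  lmod_car :> lmodType k;
  lact : R -> lmod_car -> lmod_car;
  lact_linl : forall m, linear (fun r => lact r m);
  lact_linr : forall r, linear (fun m => lact r m);
  lact1 : forall m, lact 1 m = m;
  lactA : forall m r s, lact (r * s) m = lact r (lact s m) }.

Section Tensor.
Variables (k : comNzRingType) (R : algType k) (M : rmod R) (N : lmod R).

(* A formal sum of pure tensors is a list of pairs.  The quotient below is the
   free commutative monoid on M x N modulo the usual relations; it is already
   a group, (- m, n) being an opposite of (m, n). *)
Inductive tensor_rel : seq (M * N) -> seq (M * N) -> Prop :=
| TRrefl s : tensor_rel s s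
| TRsym s t : tensor_rel s t -> tensor_rel t s
| TRtrans s t u : tensor_rel s t -> tensor_rel t u -> tensor_rel s u
| TRcat s s' t t' :
    tensor_rel s s' -> tensor_rel t t' -> tensor_rel (s ++ t) (s' ++ t')
| TRcomm s t : tensor_rel (s ++ t) (t ++ s)
| TR0 n : tensor_rel [:: (0, n)] [::]
| TRDl m m' n : tensor_rel [:: (m + m', n)] [:: (m, n); (m', n)]
| TRDr m n n' : tensor_rel [:: (m, n + n')] [:: (m, n); (m, n')]
| TRbal m r n : tensor_rel [:: (ract m r, n)] [:: (m, lact r n)].

Definition tensor_relb s t := `[< tensor_rel s t >].

Fact tensor_relb_refl : reflexive tensor_relb.
Proof. by move=> s; apply/asboolP; apply: TRrefl. Qed.
Fact tensor_relb_sym : symmetric tensor_relb.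
Proof. by move=> s t; apply/asboolP/asboolP; apply: TRsym. Qed.
Fact tensor_relb_trans : transitive tensor_relb.
Proof. by move=> t s u /asboolP h /asboolP h'; apply/asboolP; apply: TRtrans h'. Qed.

Canonical tensor_equiv :=
  EquivRel tensor_relb tensor_relb_refl tensor_relb_sym tensor_relb_trans.

Definition tensor := {eq_quot tensor_relb}.
HB.instance Definition _ : EqQuotient _ tensor_relb tensor :=
  EqQuotient.on tensor.
HB.instance Definition _ := Choice.on tensor.

Lemma tensor_eqP s t : (\pi_tensor s = \pi_tensor t) <-> tensor_rel s t.
Proof.
split=> [/eqmodP/asboolP //|h]; by apply/eqmodP/asboolP.
Qed.

Lemma tensor_repr s : tensor_rel (repr (\pi_tensor s)) s.
Proof. by apply/tensor_eqP; rewrite reprK. Qed.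

Definition tensor_add (x y : tensor) : tensor := \pi_tensor (repr x ++ repr y).
Definition tensor_opp (x : tensor) : tensor :=
  \pi_tensor [seq (- p.1, p.2) | p <- repr x].
Definition tensor_scale (c : k) (x : tensor) : tensor :=
  \pi_tensor [seq (c *: p.1, p.2) | p <- repr x].

Lemma tensor_addE s t :
  tensor_add (\pi_tensor s) (\pi_tensor t) = \pi_tensor (s ++ t).
Proof. by apply/tensor_eqP/TRcat; apply: tensor_repr. Qed.

Lemma tensor_rel_map (g : M -> M) :
    g 0 = 0 -> {morph g : x y / x + y} ->
    (forall m r, g (ract m r) = ract (g m) r) ->
  forall s t, tensor_rel s t ->
  tensor_rel [seq (g p.1, p.2) | p <- s] [seq (g p.1, p.2) | p <- t].
Proof.
move=> g0 gD gr s t; elim=> {s t} /=.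
- by move=> s; apply: TRrefl.
- by move=> s t _; apply: TRsym.
- by move=> s t u _ h _; apply: TRtrans h.
- by move=> s s' t t' _ h _ h'; rewrite !map_cat; apply: TRcat.
- by move=> s t; rewrite !map_cat; apply: TRcomm.
- by move=> n; rewrite g0; apply: TR0.
- by move=> m m' n; rewrite gD; apply: TRDl.
- by move=> m n n'; apply: TRDr.
- by move=> m r n; rewrite gr; apply: TRbal.
Qed.

Fact ractZ (c : k) (m : M) r : c *: ract m r = ract (c *: m) r.
Proof.
have h := ract_linl r (c - 1) m m.
by move: h; rewrite /= !scalerBl !scale1r !addrNK => ->.
Qed.

Lemma tensor_scaleE c s :
  tensor_scale c (\pi_tensor s) = \pi_tensor [seq (c *: p.1, p.2) | p <- s].
Proof.
apply/tensor_eqP/(tensor_rel_map (g := fun m => c *: m)).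
- exact: scaler0.
- exact: scalerDr.
- exact: ractZ.
- exact: tensor_repr.
Qed.

Fact tensor_addA : associative tensor_add.
Proof.
elim/quotW=> s; elim/quotW=> t; elim/quotW=> u.
by rewrite (tensor_addE t u) (tensor_addE s t) (tensor_addE s) tensor_addE catA.
Qed.
Fact tensor_addC : commutative tensor_add.
Proof. by move=> x y; apply/tensor_eqP/TRcomm. Qed.
Fact tensor_add0 : left_id (\pi_tensor [::]) tensor_add.
Proof. by elim/quotW=> s; rewrite tensor_addE. Qed.
Fact tensor_addN : left_inverse (\pi_tensor [::]) tensor_opp tensor_add.
Proof.
move=> x; rewrite -[X in tensor_add _ X]reprK tensor_addE; apply/tensor_eqP.
elim: (repr x) => [|[m n] s ih] /=; first exact: TRrefl.
set u := [seq _ | _ <- s] in ih *.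
have h1 : tensor_rel ((- m, n) :: u ++ (m, n) :: s)
                     ([:: (- m, n); (m, n)] ++ (u ++ s)).
  apply: (@TRcat [:: (- m, n)] [:: (- m, n)]); first exact: TRrefl.
  rewrite -[(m, n) :: s]cat1s catA.
  change (tensor_rel ((u ++ [:: (m, n)]) ++ s) (([:: (m, n)] ++ u) ++ s)).
  apply: TRcat (TRrefl _).
  exact: TRcomm.
apply: TRtrans h1 _; rewrite -[[::]]/([::] ++ [::]); apply: TRcat ih.
apply: TRtrans (TRsym (TRDl _ _ _)) _; rewrite addNr; exact: TR0.
Qed.

HB.instance Definition _ :=
  GRing.isZmodule.Build tensor tensor_addA tensor_addC tensor_add0 tensor_addN.

Lemma tensor_piD s t : \pi_tensor s + \pi_tensor t = \pi_tensor (s ++ t).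
Proof. exact: tensor_addE. Qed.

Definition tpure (m : M) (n : N) : tensor := \pi_tensor [:: (m, n)].

Lemma tensor_piE s : \pi_tensor s = \sum_(p <- s) tpure p.1 p.2.
Proof.
elim: s => [|[m n] s ih]; first by rewrite big_nil.
by rewrite big_cons -ih tensor_piD.
Qed.

Lemma tensorE (t : tensor) : t = \sum_(p <- repr t) tpure p.1 p.2.
Proof. by rewrite -tensor_piE reprK. Qed.

Fact tensor_scaleA c d (x : tensor) :
  tensor_scale c (tensor_scale d x) = tensor_scale (c * d) x.
Proof.
elim/quotW: x => s; rewrite (tensor_scaleE d) (tensor_scaleE c).
rewrite (tensor_scaleE (c * d)) -map_comp; congr (\pi_tensor _).
by apply: eq_map => p /=; rewrite scalerA.
Qed.
Fact tensor_scale1 : left_id 1 tensor_scale.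
Proof.
elim/quotW=> s; rewrite tensor_scaleE; congr (\pi_tensor _).
by rewrite -[RHS]map_id; apply: eq_map => -[m n] /=; rewrite scale1r.
Qed.
Fact tensor_scaleDr : right_distributive tensor_scale +%R.
Proof.
move=> c; elim/quotW=> s; elim/quotW=> t.
by rewrite tensor_piD (tensor_scaleE c s) (tensor_scaleE c t) tensor_piD
  (tensor_scaleE c (s ++ t)) map_cat.
Qed.

Lemma tpureDl m m' n : tpure (m + m') n = tpure m n + tpure m' n.
Proof. by rewrite [RHS]tensor_piD; apply/tensor_eqP/TRDl. Qed.
Lemma tpureDr m n n' : tpure m (n + n') = tpure m n + tpure m n'.
Proof. by rewrite [RHS]tensor_piD; apply/tensor_eqP/TRDr. Qed.
Lemma tpure_bal m r n : tpure (ract m r) n = tpure m (lact r n).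
Proof. exact/tensor_eqP/TRbal. Qed.

Fact tensor_scaleDl (x : tensor) : {morph tensor_scale^~ x : c d / c + d}.
Proof.
move=> c d /=; elim/quotW: x => s.
rewrite (tensor_scaleE (c + d)) (tensor_scaleE c) (tensor_scaleE d).
rewrite !tensor_piE !big_map.
rewrite -big_split; apply: eq_bigr => p _ /=.
by rewrite scalerDl tpureDl.
Qed.

HB.instance Definition _ := GRing.Zmodule_isLmodule.Build k tensor
  tensor_scaleA tensor_scale1 tensor_scaleDr tensor_scaleDl.

Lemma tpureZl c m n : tpure (c *: m) n = c *: tpure m n.
Proof. by rewrite [RHS]tensor_scaleE. Qed.

Lemma ract_scalar (c : k) (m : M) : ract m c%:A = c *: m.
Proof.
have h := ract_linr m (c - 1) 1 1.
by move: h; rewrite /= !scalerBl !scale1r !addrNK !ract1 => ->.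
Qed.

Lemma lact_scalar (c : k) (n : N) : lact c%:A n = c *: n.
Proof.
have h := lact_linl n (c - 1) 1 1.
by move: h; rewrite /= !scalerBl !scale1r !addrNK !lact1 => ->.
Qed.

Lemma tpureZr c m n : tpure m (c *: n) = c *: tpure m n.
Proof. by rewrite -lact_scalar -tpure_bal ract_scalar tpureZl. Qed.

(* [tsum t f] is the value at t of the map sending each pure tensor of m and n
   to f m n; it does not depend on the chosen representative as soon as f is
   bilinear and balanced ([tsum_pure], [tsum_lin]). *)
Definition tsum (V : zmodType) (t : tensor) (f : M -> N -> V) : V :=
  \sum_(p <- repr t) f p.1 p.2.

Record tbilinear (V : lmodType k) (f : M -> N -> V) : Prop := TBilinear {
  tbilinearl : forall n, linear (f^~ n);
  tbilinearr : forall m, linear (f m);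
  tbilinear_bal : forall m r n, f (ract m r) n = f m (lact r n) }.

Fact linear_add (U V : lmodType k) (f : U -> V) :
  linear f -> {morph f : x y / x + y}.
Proof. by move=> lf x y; have := lf 1 x y; rewrite /= !scale1r. Qed.

Fact linear_zero (U V : lmodType k) (f : U -> V) : linear f -> f 0 = 0.
Proof.
by move=> lf; have := lf (-1) 0 0; rewrite /= !scaleN1r !addNr.
Qed.

Section Fold.
Variables (V : lmodType k) (f : M -> N -> V).
Hypothesis hf : tbilinear f.

Lemma tsum_pi s : tsum (\pi_tensor s) f = \sum_(p <- s) f p.1 p.2.
Proof.
suff h t t' : tensor_rel t t' ->
    \sum_(p <- t) f p.1 p.2 = \sum_(p <- t') f p.1 p.2.
  exact: h (tensor_repr s).
elim=> {s t t'} //=.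
- by move=> s t u _ -> _ ->.
- by move=> s s' t t' _ h _ h'; rewrite !big_cat /= h h'.
- by move=> s t; rewrite !big_cat /= addrC.
- by move=> n; rewrite big_seq1 big_nil (linear_zero (tbilinearl hf n)).
- by move=> m m' n; rewrite !big_cons !big_nil !addr0
    (linear_add (tbilinearl hf n)).
- by move=> m n n'; rewrite !big_cons !big_nil !addr0
    (linear_add (tbilinearr hf m)).
- by move=> m r n; rewrite !big_seq1 /= (tbilinear_bal hf).
Qed.

Lemma tsum_pure m n : tsum (tpure m n) f = f m n.
Proof. by rewrite tsum_pi big_seq1. Qed.

Lemma tsum_lin : linear (fun t => tsum t f).
Proof.
move=> c; elim/quotW=> s; elim/quotW=> t.
rewrite [c *: _]tensor_scaleE tensor_piD !tsum_pi big_cat big_map; congr (_ + _).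
rewrite scaler_sumr; apply: eq_bigr => p _.
have := tbilinearl hf p.2 c p.1 0.
by rewrite !addr0 /= (linear_zero (tbilinearl hf p.2)) addr0.
Qed.

End Fold.

Lemma tensor_linear_ext (V : lmodType k) (f g : tensor -> V) :
  linear f -> linear g -> (forall m n, f (tpure m n) = g (tpure m n)) -> f =1 g.
Proof.
move=> lf lg h t; rewrite (tensorE t); elim: (repr t) => [|p s ih].
  by rewrite !big_nil (linear_zero lf) (linear_zero lg).
by rewrite !big_cons (linear_add lf) (linear_add lg) ih h.
Qed.

Lemma tsum_comp (V W : lmodType k) (f : M -> N -> V) (g : V -> W) t :
  linear g -> g (tsum t f) = tsum t (fun m n => g (f m n)).
Proof.
move=> lg; rewrite /tsum; elim: (repr t) => [|p s ih].
  by rewrite !big_nil (linear_zero lg).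
by rewrite !big_cons (linear_add lg) ih.
Qed.

Lemma eq_tsum (V : zmodType) (f g : M -> N -> V) t :
  (forall m n, f m n = g m n) -> tsum t f = tsum t g.
Proof. by move=> h; apply: eq_bigr => p _; apply: h. Qed.

End Tensor.

Section BaseModules.
Variables (k : comNzRingType) (M : lmodType k).

Definition base_ract (m : M) (c : k^o) : M := (c : k) *: m.
Definition base_lact (c : k^o) (m : M) : M := (c : k) *: m.

Fact base_linm (c : k^o) : linear (fun m : M => (c : k) *: m).
Proof. by move=> d x y; rewrite scalerDr !scalerA mulrC. Qed.
Fact base_linc (m : M) : linear (fun c : k^o => (c : k) *: m).
Proof. by move=> d x y; rewrite scalerDl scalerA. Qed.
Fact base_1 (m : M) : (1 : k) *: m = m.
Proof. exact: scale1r. Qed.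
Fact base_rA (m : M) (c d : k^o) : base_ract m (c * d) = base_ract (base_ract m c) d.
Proof. by rewrite /base_ract scalerA mulrC. Qed.
Fact base_lA (m : M) (c d : k^o) : base_lact (c * d) m = base_lact c (base_lact d m).
Proof. by rewrite /base_lact scalerA. Qed.

Definition base_rmod : rmod k^o := RMod base_linm base_linc base_1 base_rA.
Definition base_lmod : lmod k^o := LMod base_linc base_linm base_1 base_lA.

End BaseModules.

Notation "M \otimes N" := (tensor (base_rmod M) (base_lmod N)) : type_scope.

Section BaseTensor.
Variables (k : comNzRingType) (M N : lmodType k).

Definition ktensor (m : M) (n : N) : (M \otimes N)%type :=
  @tpure k k^o (base_rmod M) (base_lmod N) m n.

Definition ktsum (V : zmodType) (t : (M \otimes N)%type) (f : M -> N -> V) : V :=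
  @tsum k k^o (base_rmod M) (base_lmod N) V t f.

End BaseTensor.

Notation "x \ox y" := (ktensor x y) : ring_scope.
(* Sweedler sums: when [t] is the coproduct of h, or a coaction, the sum of
   E over the legs x and y of t. *)
Notation "\tsum_ ( x & y <- t ) E" := (ktsum t (fun x y => E)) : ring_scope.

Section BaseTensorTheory.
Variables (k : comNzRingType) (M N : lmodType k).
Implicit Types (t : (M \otimes N)%type).

Definition kbilinear (V : lmodType k) (f : M -> N -> V) : Prop :=
  (forall n, linear (f^~ n)) /\ (forall m, linear (f m)).

Fact linear_scale (U V : lmodType k) (f : U -> V) c x :
  linear f -> f (c *: x) = c *: f x.
Proof. by move=> lf; have := lf c x 0; rewrite /= (linear_zero lf) !addr0. Qed.

Lemma kbilinearP (V : lmodType k) (f : M -> N -> V) :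
  kbilinear f -> @tbilinear k k^o (base_rmod M) (base_lmod N) V f.
Proof.
case=> fl fr; split=> //= m c n; rewrite /base_ract /base_lact.
by rewrite (linear_scale c m (fl n)) (linear_scale c n (fr m)).
Qed.

Lemma ktsum_pure (V : lmodType k) (f : M -> N -> V) m n :
  kbilinear f -> ktsum (m \ox n) f = f m n.
Proof. by move=> /kbilinearP/tsum_pure; apply. Qed.

Lemma ktsum_lin (V : lmodType k) (f : M -> N -> V) :
  kbilinear f -> linear (fun t => ktsum t f).
Proof. by move=> /kbilinearP/tsum_lin. Qed.

Lemma ktensor_lin_ext (V : lmodType k) (f g : (M \otimes N)%type -> V) :
  linear f -> linear g -> (forall m n, f (m \ox n) = g (m \ox n)) -> f =1 g.
Proof. exact: tensor_linear_ext. Qed.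

Lemma ktsum_comp (V W : lmodType k) (f : M -> N -> V) (g : V -> W) t :
  linear g -> g (ktsum t f) = ktsum t (fun m n => g (f m n)).
Proof. exact: (@tsum_comp k k^o (base_rmod M) (base_lmod N)). Qed.

Lemma eq_ktsum (V : zmodType) (f g : M -> N -> V) t :
  (forall m n, f m n = g m n) -> ktsum t f = ktsum t g.
Proof. by move=> h; exact: (@eq_tsum k k^o (base_rmod M) (base_lmod N)). Qed.

Lemma ktsum_id t : \tsum_(m & n <- t) (m \ox n) = t.
Proof. by rewrite [RHS]tensorE. Qed.

Lemma ktsum_exchange (P Q : lmodType k) (V : zmodType) (f : M -> N -> P -> Q -> V)
    t (u : (P \otimes Q)%type) :
  \tsum_(m & n <- t) \tsum_(p & q <- u) f m n p q =
  \tsum_(p & q <- u) \tsum_(m & n <- t) f m n p q.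
Proof. exact: exchange_big. Qed.

End BaseTensorTheory.

Arguments ktsum_comp {k M N V W f} g {t}.

Section Lin.
Variable k : comNzRingType.
Implicit Types U V W M N : lmodType k.

Lemma lin_id U : linear (fun x : U => x). Proof. by []. Qed.
Lemma lin_app U V W (f : {linear V -> W}) (g : U -> V) :
  linear g -> linear (fun x => f (g x)).
Proof. by move=> lg c x y; rewrite lg linearP. Qed.
Lemma lin_comp U V W (f : V -> W) (g : U -> V) :
  linear f -> linear g -> linear (fun x => f (g x)).
Proof. by move=> lf lg c x y; rewrite lg lf. Qed.
Lemma lin_mull U (A : algType k) (g : U -> A) a :
  linear g -> linear (fun x => g x * a).
Proof. by move=> lg c x y; rewrite lg mulrDl scalerAl. Qed.
Lemma lin_mulr U (A : algType k) (g : U -> A) a :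
  linear g -> linear (fun x => a * g x).
Proof. by move=> lg c x y; rewrite lg mulrDr scalerAr. Qed.
Lemma lin_oxl U M N (g : U -> M) (n : N) :
  linear g -> linear (fun x => g x \ox n).
Proof. by move=> lg c x y; rewrite lg /ktensor tpureDl tpureZl. Qed.
Lemma lin_oxr U M N (g : U -> N) (m : M) :
  linear g -> linear (fun x => m \ox g x).
Proof.
by move=> lg c x y; rewrite lg /ktensor tpureDr
  (@tpureZr k k^o (base_rmod M) (base_lmod N)).
Qed.
Lemma lin_scal U V (A : algType k) (e : {lrmorphism A -> k | *%R}) (g : U -> A)
    (v : V) :
  linear g -> linear (fun x => e (g x) *: v).
Proof.
by move=> lg c x y; rewrite lg linearD linearZ scalerDl scalerA.
Qed.
Lemma lin_scalr U V (c : k) (g : U -> V) :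
  linear g -> linear (fun x => c *: g x).
Proof. by move=> lg d x y; rewrite lg scalerDr !scalerA mulrC. Qed.
Lemma lin_tsum_body U V M N (f : U -> M -> N -> V) (t : (M \otimes N)%type) :
  (forall m n, linear (fun x => f x m n)) ->
  linear (fun x => \tsum_(m & n <- t) f x m n).
Proof.
move=> lf c x y; rewrite /ktsum /tsum scaler_sumr -big_split /=.
by apply: eq_bigr => p _; apply: lf.
Qed.
Lemma lin_tsum_arg U V M N (f : M -> N -> V) (g : U -> (M \otimes N)%type) :
  linear g -> (forall n, linear (fun m => f m n)) ->
  (forall m, linear (fun n => f m n)) ->
  linear (fun x => \tsum_(m & n <- g x) f m n).
Proof. by move=> lg h1 h2 c x y; rewrite lg (ktsum_lin (conj h1 h2)). Qed.
Lemma lin_ractl U (R : algType k) (M : rmod R) (g : U -> M) r :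
  linear g -> linear (fun x => ract (g x) r).
Proof. by move=> lg c x y; rewrite lg ract_linl. Qed.
Lemma lin_ractr U (R : algType k) (M : rmod R) (g : U -> R) (m : M) :
  linear g -> linear (fun x => ract m (g x)).
Proof. by move=> lg c x y; rewrite lg ract_linr. Qed.
Lemma lin_purel U (R : algType k) (M : rmod R) (N : lmod R) (g : U -> M) (n : N) :
  linear g -> linear (fun x => tpure (g x) n).
Proof. by move=> lg c x y; rewrite lg tpureDl tpureZl. Qed.
Lemma lin_purer U (R : algType k) (M : rmod R) (N : lmod R) (g : U -> N) (m : M) :
  linear g -> linear (fun x => tpure m (g x)).
Proof. by move=> lg c x y; rewrite lg tpureDr tpureZr. Qed.

End Lin.

Ltac lin1 :=
  match goal with
  | |- linear ?f =>
      lazymatch f with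
      | (fun _ => _) => fail
      | _ => first [exact: linearP | change (linear (fun x => f x))]
      end
  | |- linear (fun x => x) => exact: lin_id
  | |- linear (fun x => _ \ox _) => first [apply: lin_oxl | apply: lin_oxr]
  | |- linear (fun x => ktsum _ _) =>
      first [apply: lin_tsum_body => ? ? | apply: lin_tsum_arg => [|?|?]]
  | |- linear (fun x => tpure _ _) => first [apply: lin_purel | apply: lin_purer]
  | |- linear (fun x => ract _ _) => first [apply: lin_ractl | apply: lin_ractr]
  | |- linear (fun x => _ * _) => first [apply: lin_mull | apply: lin_mulr]
  | |- linear (fun x => _ *: _) => first [apply: lin_scal | apply: lin_scalr]
  | |- _ => apply: lin_app
  end.
Ltac lin := intros; cbv beta; repeat (lin1; cbv beta).

Lemma tsum_tsum (k : comNzRingType) (M N P Q V : lmodType k) (f : P -> Q -> V)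
    (g : M -> N -> (P \otimes Q)%type) (t : (M \otimes N)%type) :
  kbilinear f ->
  \tsum_(p & q <- \tsum_(m & n <- t) g m n) f p q =
  \tsum_(m & n <- t) \tsum_(p & q <- g m n) f p q.
Proof. by move=> hf; rewrite (ktsum_comp _ (ktsum_lin hf)). Qed.

Record hopfAlg (k : comNzRingType) := HopfAlg {
  hopf_car :> algType k;
  comul : {linear hopf_car -> (hopf_car \otimes hopf_car)%type};
  counit : {lrmorphism hopf_car -> k | *%R};
  antipode : {linear hopf_car -> hopf_car};
  comulA : forall h,
    \tsum_(x & y <- comul h) \tsum_(x1 & x2 <- comul x) (x1 \ox (x2 \ox y)) =
    \tsum_(x & y <- comul h) \tsum_(y1 & y2 <- comul y) (x \ox (y1 \ox y2));
  counitl : forall h, \tsum_(x & y <- comul h) (counit x *: y) = h;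
  counitr : forall h, \tsum_(x & y <- comul h) (counit y *: x) = h;
  comulM : forall g h, comul (g * h) =
    \tsum_(g1 & g2 <- comul g) \tsum_(h1 & h2 <- comul h)
      ((g1 * h1) \ox (g2 * h2));
  comul1 : comul 1 = 1 \ox 1;
  antipodel : forall h,
    \tsum_(x & y <- comul h) (antipode x * y) = (counit h)%:A;
  antipoder : forall h,
    \tsum_(x & y <- comul h) (x * antipode y) = (counit h)%:A }.

Arguments comul {k _}.
Arguments counit {k _}.
Arguments antipode {k _}.

Record bijHopfAlg (k : comNzRingType) := BijHopfAlg {
  bijHopf_car :> hopfAlg k;
  antipode_bij : bijective (@antipode k bijHopf_car) }.

Fact bijective_inv_ex (T U : Type) (f : T -> U) :
  bijective f -> exists g, cancel f g /\ cancel g f.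
Proof. by case=> g; exists g. Qed.

Definition antipode_inv (k : comNzRingType) (H : bijHopfAlg k) : H -> H :=
  projT1 (cid (bijective_inv_ex (antipode_bij H))).

Fact antipodeK (k : comNzRingType) (H : bijHopfAlg k) :
  cancel (@antipode k H) (@antipode_inv k H).
Proof. by rewrite /antipode_inv; case: cid => g /= []. Qed.
Fact antipode_invK (k : comNzRingType) (H : bijHopfAlg k) :
  cancel (@antipode_inv k H) (@antipode k H).
Proof. by rewrite /antipode_inv; case: cid => g /= []. Qed.

Section Trilinear.
Variables (k : comNzRingType) (M N P V : lmodType k) (F : M -> N -> P -> V).

Definition trilin : Prop :=
  [/\ forall b c, linear (fun a => F a b c),
      forall a c, linear (fun b => F a b c) &
      forall a b, linear (fun c => F a b c)].

Definition ev3 (t : (M \otimes (N \otimes P))%type) : V :=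
  \tsum_(a & u <- t) \tsum_(b & c <- u) F a b c.

Hypothesis hF : trilin.

Lemma ev3_bil : kbilinear (fun a (u : (N \otimes P)%type) =>
  \tsum_(b & c <- u) F a b c).
Proof.
case: hF => h1 h2 h3; split=> ?; cbv beta.
  by apply: lin_tsum_body => b c; apply: h1.
by apply: (ktsum_lin (conj _ _)).
Qed.

Lemma ev3_lin : linear ev3.
Proof. exact: ktsum_lin ev3_bil. Qed.

Lemma ev3_pure a b c : ev3 (a \ox (b \ox c)) = F a b c.
Proof.
rewrite /ev3 (ktsum_pure _ _ ev3_bil) ktsum_pure //.
by case: hF => h1 h2 h3; split.
Qed.

End Trilinear.

Lemma ev3_tsum (k : comNzRingType) (M N P Q S V : lmodType k)
    (F : M -> N -> P -> V) (g : Q -> S -> (M \otimes (N \otimes P))%type) t :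
  trilin F -> ev3 F (ktsum t g) = \tsum_(q & s <- t) ev3 F (g q s).
Proof. by move=> hF; rewrite (ktsum_comp _ (ev3_lin hF)). Qed.

Lemma ev3_tsum2 (k : comNzRingType) (M N P Q S V : lmodType k)
    (F : M -> N -> P -> V) (g1 : Q -> S -> M) (g2 : Q -> S -> N)
    (g3 : Q -> S -> P) t :
  trilin F ->
  ev3 F (\tsum_(q & s <- t) (g1 q s \ox (g2 q s \ox g3 q s))) =
  \tsum_(q & s <- t) F (g1 q s) (g2 q s) (g3 q s).
Proof.
by move=> hF; rewrite ev3_tsum //; apply: eq_ktsum => q s; rewrite ev3_pure.
Qed.

Section HopfTheory.
Variables (k : comNzRingType) (H : hopfAlg k).
Implicit Types g h : H.

Lemma comul3 (V : lmodType k) (F : H -> H -> H -> V) h : trilin F ->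
  \tsum_(x & y <- comul h) \tsum_(x1 & x2 <- comul x) F x1 x2 y =
  \tsum_(x & y <- comul h) \tsum_(y1 & y2 <- comul y) F x y1 y2.
Proof.
move=> hF; have := congr1 (ev3 F) (comulA h); rewrite !ev3_tsum // => e.
rewrite -(eq_ktsum _ (fun x y => ev3_tsum2 _ _ _ _ hF)) e.
by apply: eq_ktsum => x y; rewrite ev3_tsum2.
Qed.

Lemma conv_uniq (V : lmodType k) (mul : V -> V -> V) (one : V) (F D G : H -> V) :
  (forall v, linear (fun u => mul u v)) -> (forall u, linear (mul u)) ->
  (forall u v w, mul u (mul v w) = mul (mul u v) w) ->
  (forall u, mul one u = u) -> (forall u, mul u one = u) ->
  linear F -> linear D -> linear G ->
  (forall h, \tsum_(x & y <- comul h) mul (F x) (D y) = counit h *: one) ->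
  (forall h, \tsum_(x & y <- comul h) mul (D x) (G y) = counit h *: one) ->
  F =1 G.
Proof.
move=> ml mr mA m1l m1r lF lD lG FD DG h.
have -> : F h = \tsum_(x & y <- comul h) mul (F x) (counit y *: one).
  rewrite -{1}(counitr h) (ktsum_comp _ lF); apply: eq_ktsum => x y.
  by rewrite (linear_scale _ _ lF) (linear_scale _ _ (mr _)) m1r.
have -> : G h = \tsum_(x & y <- comul h) mul (counit x *: one) (G y).
  rewrite -{1}(counitl h) (ktsum_comp _ lG); apply: eq_ktsum => x y.
  by rewrite (linear_scale _ _ lG) (linear_scale _ _ (ml _)) m1l.
transitivity (\tsum_(x & y <- comul h) \tsum_(y1 & y2 <- comul y)
   mul (F x) (mul (D y1) (G y2))).
  by apply: eq_ktsum => x y; rewrite -DG (ktsum_comp _ (mr _)).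
rewrite -(@comul3 _ (fun a b c => mul (F a) (mul (D b) (G c)))); last first.
  split=> ? ? c x y; first by rewrite lF ml.
    by rewrite lD ml mr.
  by rewrite lG !mr.
apply: eq_ktsum => x y; rewrite -FD (ktsum_comp _ (ml _)).
by apply: eq_ktsum => a b; rewrite mA.
Qed.

Lemma antipode1 : antipode (1 : H) = 1.
Proof.
have := antipodel (1 : H); rewrite comul1 ktsum_pure ?mulr1; last by split; lin.
by rewrite rmorph1 scale1r.
Qed.

Lemma counit_lin : linear (fun h : H => counit h : k^o).
Proof. by move=> c x y; rewrite linearD linearZ. Qed.

Lemma counit_antipode h : counit (antipode h) = counit h.
Proof.
have lSe : linear (fun h : H => counit (antipode h) : k^o).
  by apply: (lin_comp counit_lin); lin.
rewrite -[in LHS](counitr h) (ktsum_comp _ lSe).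
transitivity (counit (\tsum_(x & y <- comul h) (antipode x * y))); last first.
  by rewrite antipodel linearZ rmorph1 /= mulr1.
rewrite (ktsum_comp _ counit_lin); apply: eq_ktsum => x y.
by rewrite (linear_scale _ _ lSe) rmorphM mulrC.
Qed.

Lemma antipodeM g h : antipode (g * h) = antipode h * antipode g.
Proof.
have e1 : antipode (g * h) =
  \tsum_(g1 & g2 <- comul g) \tsum_(h1 & h2 <- comul h)
    (antipode (g1 * h1) * (counit h2 *: (counit g2)%:A)).
  rewrite -{1}(counitr g) (ktsum_comp (fun x => antipode (x * h))); last lin.
  apply: eq_ktsum => g1 g2.
  rewrite -{1}(counitr h).
  rewrite (ktsum_comp (fun x => antipode (counit g2 *: g1 * x))); last lin.
  apply: eq_ktsum => h1 h2.
  by rewrite -!scalerAl !linearZ /= -!scalerAr mulr1 linearZ.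
rewrite {}e1.
transitivity (\tsum_(g1 & g2 <- comul g) \tsum_(h1 & h2 <- comul h)
  \tsum_(x & y <- comul g2) \tsum_(z & w <- comul h2)
   (antipode (g1 * h1) * (x * z) * (antipode w * antipode y))).
  apply: eq_ktsum => g1 g2; apply: eq_ktsum => h1 h2.
  rewrite -(antipoder g2).
  rewrite (ktsum_comp (fun u => antipode (g1 * h1) * (counit h2 *: u))); last lin.
  apply: eq_ktsum => x y.
  have -> : counit h2 *: (x * antipode y) = x * (counit h2)%:A * antipode y.
    by rewrite -scalerAr mulr1 -scalerAl.
  rewrite -(antipoder h2).
  rewrite (ktsum_comp (fun u => antipode (g1 * h1) * (x * u * antipode y))); last lin.
  by apply: eq_ktsum => z w; rewrite !mulrA.
under eq_ktsum => g1 g2 do rewrite ktsum_exchange.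
rewrite -(@comul3 _ (fun a b c => \tsum_(h1 & h2 <- comul h)
   \tsum_(z & w <- comul h2)
    (antipode (a * h1) * (b * z) * (antipode w * antipode c)))); last by split; lin.
transitivity (\tsum_(g1 & g2 <- comul g) \tsum_(x & y <- comul g1)
  \tsum_(h1 & h2 <- comul h) \tsum_(z & w <- comul h1)
   (antipode (x * z) * (y * w) * (antipode h2 * antipode g2))).
  apply: eq_ktsum => g1 g2; apply: eq_ktsum => x y.
  by rewrite -(@comul3 _ (fun a b c =>
    antipode (x * a) * (y * b) * (antipode c * antipode g2))); last by split; lin.
transitivity (\tsum_(g1 & g2 <- comul g) \tsum_(h1 & h2 <- comul h)
  (counit (g1 * h1) *: (antipode h2 * antipode g2))).
  apply: eq_ktsum => g1 g2; rewrite ktsum_exchange; apply: eq_ktsum => h1 h2.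
  rewrite -[_ *: _]mul1r -scalerAr scalerAl -antipodel comulM.
  rewrite (ktsum_comp (fun t => ktsum t _ * _)); last lin.
  apply: eq_ktsum => x y.
  rewrite (ktsum_comp (fun t => ktsum t _ * _)); last lin.
  by apply: eq_ktsum => z w; rewrite ktsum_pure //; split; lin.
rewrite -[in RHS](counitl g) -[in RHS](counitl h).
rewrite (ktsum_comp (fun u => antipode _ * antipode u)); last lin.
apply: eq_ktsum => g1 g2.
rewrite (ktsum_comp (fun u => antipode u * antipode _)); last lin.
apply: eq_ktsum => h1 h2.
by rewrite rmorphM !linearZ /= -scalerAl -scalerAr scalerA mulrC.
Qed.

Definition tmul (u v : (H \otimes H)%type) : (H \otimes H)%type :=
  \tsum_(a & b <- u) \tsum_(c & d <- v) ((a * c) \ox (b * d)).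

Lemma tmul_linl v : linear (fun u => tmul u v).
Proof. by rewrite /tmul; lin. Qed.
Lemma tmul_linr u : linear (tmul u).
Proof. by rewrite /tmul; lin. Qed.

Lemma tmul_pure a b c d : tmul (a \ox b) (c \ox d) = (a * c) \ox (b * d).
Proof. by rewrite /tmul ktsum_pure ?ktsum_pure //; split; lin. Qed.

Lemma tmulA u v w : tmul u (tmul v w) = tmul (tmul u v) w.
Proof.
move: u; apply: ktensor_lin_ext.
- exact: tmul_linl.
- by apply: (lin_comp (f := tmul^~ w)); [apply: tmul_linl|apply: tmul_linl].
move=> a b; move: v; apply: ktensor_lin_ext.
- apply: (lin_comp (f := tmul _)); [exact: tmul_linr|exact: tmul_linl].
- apply: (lin_comp (f := tmul^~ w)); [exact: tmul_linl|exact: tmul_linr].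
move=> c d; move: w; apply: ktensor_lin_ext.
- apply: (lin_comp (f := tmul _)); exact: tmul_linr.
- exact: tmul_linr.
by move=> e f; rewrite !tmul_pure !mulrA.
Qed.

Lemma tmul1l u : tmul (1 \ox 1) u = u.
Proof.
move: u; apply: ktensor_lin_ext; [exact: tmul_linr|exact: lin_id|].
by move=> a b; rewrite tmul_pure !mul1r.
Qed.
Lemma tmul1r u : tmul u (1 \ox 1) = u.
Proof.
move: u; apply: ktensor_lin_ext; [exact: tmul_linl|exact: lin_id|].
by move=> a b; rewrite tmul_pure !mulr1.
Qed.

Lemma comul_tmul g h : comul (g * h) = tmul (comul g) (comul h).
Proof. exact: comulM. Qed.

Lemma comul_antipode h :
  comul (antipode h) = \tsum_(x & y <- comul h) (antipode y \ox antipode x).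
Proof.
apply: (@conv_uniq _ tmul (1 \ox 1) (fun h => comul (antipode h)) comul
  (fun h => \tsum_(x & y <- comul h) (antipode y \ox antipode x))).
- exact: tmul_linl.
- exact: tmul_linr.
- exact: tmulA.
- exact: tmul1l.
- exact: tmul1r.
- lin.
- exact: linearP.
- lin.
- move=> {}h; under eq_ktsum => x y do rewrite -comul_tmul.
  rewrite -(ktsum_comp (comul)); last exact: linearP.
  by rewrite antipodel linearZ comul1.
move=> {}h; rewrite /tmul.
transitivity (\tsum_(x & y <- comul h)
  \tsum_(a & b <- comul x) \tsum_(c & d <- comul y)
    ((a * antipode d) \ox (b * antipode c))).
  apply: eq_ktsum => x y; apply: eq_ktsum => a b.
  rewrite tsum_tsum; last by split; lin.
  by apply: eq_ktsum => c d; rewrite ktsum_pure //; split; lin.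
rewrite (@comul3 _ (fun a b y => \tsum_(c & d <- comul y)
    ((a * antipode d) \ox (b * antipode c)))); last by split; lin.
transitivity (\tsum_(x & y <- comul h) ((x * antipode y) \ox (1 : H))).
  apply: eq_ktsum => x y.
  rewrite -(@comul3 _ (fun a b d => (x * antipode d) \ox (a * antipode b)));
    last by split; lin.
  rewrite -[in RHS](counitl y).
  rewrite (ktsum_comp (fun d => (x * antipode d) \ox 1)); last lin.
  apply: eq_ktsum => a b.
  rewrite -(ktsum_comp (fun u => (x * antipode b) \ox u)); last lin.
  rewrite antipoder linearZ /= -scalerAr /ktensor tpureZl.
  exact: (@tpureZr k k^o (base_rmod H) (base_lmod H)).
rewrite -(ktsum_comp (fun u => u \ox 1)); last lin.
by rewrite antipoder /ktensor tpureZl.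
Qed.

End HopfTheory.

Section AntipodeInv.
Variables (k : comNzRingType) (H : bijHopfAlg k).
Implicit Types g h : H.
Local Notation Sinv := (@antipode_inv k H).

Fact antipode_inv_linear : linear Sinv.
Proof.
move=> c x y; apply: (can_inj (antipodeK (H := H))).
by rewrite antipode_invK linearP !antipode_invK.
Qed.

HB.instance Definition _ :=
  GRing.isLinear.Build k H H *:%R Sinv antipode_inv_linear.

Lemma antipode_invM g h : Sinv (g * h) = Sinv h * Sinv g.
Proof.
apply: (can_inj (antipodeK (H := H))).
by rewrite antipodeM !antipode_invK.
Qed.

Lemma antipode_inv1 : Sinv 1 = 1.
Proof.
by apply: (can_inj (antipodeK (H := H))); rewrite antipode_invK antipode1.
Qed.

Lemma counit_antipode_inv h : counit (Sinv h) = counit h.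
Proof. by rewrite -counit_antipode antipode_invK. Qed.

Lemma comul_antipode_inv h :
  comul (Sinv h) = \tsum_(x & y <- comul h) (Sinv y \ox Sinv x).
Proof.
rewrite -{2}(antipode_invK h) comul_antipode tsum_tsum; last by split; lin.
rewrite -[LHS]ktsum_id; apply: eq_ktsum => x y.
by rewrite ktsum_pure ?antipodeK //; split; lin.
Qed.

End AntipodeInv.

Record bicomodAlg (k : comNzRingType) (H : hopfAlg k) := BicomodAlg {
  bicomod_car :> algType k;
  lcoact : {linear bicomod_car -> (H \otimes bicomod_car)%type};
  rcoact : {linear bicomod_car -> (bicomod_car \otimes H)%type};
  lcoactA : forall a,
    \tsum_(h & x <- lcoact a) \tsum_(h1 & h2 <- comul h) (h1 \ox (h2 \ox x)) =
    \tsum_(h & x <- lcoact a) \tsum_(g & y <- lcoact x) (h \ox (g \ox y));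
  lcoact_counit : forall a, \tsum_(h & x <- lcoact a) (counit h *: x) = a;
  rcoactA : forall a,
    \tsum_(x & h <- rcoact a) \tsum_(y & g <- rcoact x) (y \ox (g \ox h)) =
    \tsum_(x & h <- rcoact a) \tsum_(h1 & h2 <- comul h) (x \ox (h1 \ox h2));
  rcoact_counit : forall a, \tsum_(x & h <- rcoact a) (counit h *: x) = a;
  bicoactA : forall a,
    \tsum_(x & h <- rcoact a) \tsum_(g & y <- lcoact x) (g \ox (y \ox h)) =
    \tsum_(g & x <- lcoact a) \tsum_(y & h <- rcoact x) (g \ox (y \ox h));
  lcoactM : forall a b, lcoact (a * b) =
    \tsum_(g & x <- lcoact a) \tsum_(h & y <- lcoact b) ((g * h) \ox (x * y));
  lcoact1 : lcoact 1 = 1 \ox 1;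
  rcoactM : forall a b, rcoact (a * b) =
    \tsum_(x & g <- rcoact a) \tsum_(y & h <- rcoact b) ((x * y) \ox (g * h));
  rcoact1 : rcoact 1 = 1 \ox 1 }.
Arguments lcoact {k H _}.
Arguments rcoact {k H _}.

Ltac linF3 h1 h2 h3 := intros; cbv beta;
  repeat (first [apply: (lin_comp (h1 _ _)) | apply: (lin_comp (h2 _ _))
                | apply: (lin_comp (h3 _ _)) | lin1]; cbv beta).

Section QuantumYD.
Variables (k : comNzRingType) (H : bijHopfAlg k) (A : bicomodAlg H).

(* \sum S^-1(a_<1>) a_<-1> \ox a_<0>; the inner sums compute
   a_<-1> \ox a_<0> \ox a_<1> as (lcoact \ox id) (rcoact a). *)
Definition verma (a : A) : (H \otimes A)%type :=
  \tsum_(x & h <- rcoact a) \tsum_(g & y <- lcoact x)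
    ((antipode_inv h * g) \ox y).

Record ydmod := YDMod {
  yd_rmod :> rmod A;
  yd_coact : {linear yd_rmod -> (H \otimes yd_rmod)%type};
  yd_coactA : forall m,
    \tsum_(h & n <- yd_coact m) \tsum_(h1 & h2 <- comul h)
      (h1 \ox (h2 \ox n)) =
    \tsum_(h & n <- yd_coact m) \tsum_(g & p <- yd_coact n) (h \ox (g \ox p));
  yd_counit : forall m, \tsum_(h & n <- yd_coact m) (counit h *: n) = m;
  yd_compat : forall m a, yd_coact (ract m a) =
    \tsum_(h & n <- yd_coact m) \tsum_(x & g <- rcoact a)
      \tsum_(f & y <- lcoact x)
        ((antipode_inv g * h * f) \ox (ract n y)) }.

(* The first clause is the k-linearity of gam as a map from H to Hom(H, A). *)
Definition quantum_integral (gam : H -> {linear H -> A}) : Prop :=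
  (forall (c : k) (g g' h : H),
     gam (c *: g + g') h = c *: gam g h + gam g' h) /\
  (forall g h : H,
     \tsum_(g1 & g2 <- comul g) (g1 \ox gam g2 h) =
     \tsum_(h1 & h2 <- comul h) \tsum_(x & f <- rcoact (gam g h1))
       \tsum_(e & y <- lcoact x) ((antipode_inv f * h2 * e) \ox y)).

Definition total_integral (gam : H -> {linear H -> A}) : Prop :=
  forall h : H, \tsum_(h1 & h2 <- comul h) gam h1 h2 = counit h *: 1.

Fact verma_linear : linear verma.
Proof. by rewrite /verma; lin. Qed.
HB.instance Definition _ :=
  GRing.isLinear.Build k A (H \otimes A)%type *:%R verma verma_linear.

Lemma lcoact3 (V : lmodType k) (F : H -> H -> A -> V) (a : A) : trilin F ->
  \tsum_(h & x <- lcoact a) \tsum_(h1 & h2 <- comul h) F h1 h2 x =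
  \tsum_(h & x <- lcoact a) \tsum_(g & y <- lcoact x) F h g y.
Proof.
move=> hF; have := congr1 (ev3 F) (lcoactA a); rewrite !ev3_tsum // => e.
rewrite -(eq_ktsum _ (fun x y => ev3_tsum2 _ _ _ _ hF)) e.
by apply: eq_ktsum => x y; rewrite ev3_tsum2.
Qed.

Lemma rcoact3 (V : lmodType k) (F : A -> H -> H -> V) (a : A) : trilin F ->
  \tsum_(x & h <- rcoact a) \tsum_(y & g <- rcoact x) F y g h =
  \tsum_(x & h <- rcoact a) \tsum_(h1 & h2 <- comul h) F x h1 h2.
Proof.
move=> hF; have := congr1 (ev3 F) (rcoactA a); rewrite !ev3_tsum // => e.
rewrite -(eq_ktsum _ (fun x y => ev3_tsum2 _ _ _ _ hF)) e.
by apply: eq_ktsum => x y; rewrite ev3_tsum2.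
Qed.

Lemma bicoact3 (V : lmodType k) (F : H -> A -> H -> V) (a : A) : trilin F ->
  \tsum_(x & h <- rcoact a) \tsum_(g & y <- lcoact x) F g y h =
  \tsum_(g & x <- lcoact a) \tsum_(y & h <- rcoact x) F g y h.
Proof.
move=> hF; have := congr1 (ev3 F) (bicoactA a); rewrite !ev3_tsum // => e.
rewrite -(eq_ktsum _ (fun x y => ev3_tsum2 _ _ _ _ hF)) e.
by apply: eq_ktsum => x y; rewrite ev3_tsum2.
Qed.

Lemma verma_tsum (V : lmodType k) (F : H -> A -> V) (a : A) : kbilinear F ->
  \tsum_(h & x <- verma a) F h x =
  \tsum_(x & h <- rcoact a) \tsum_(g & y <- lcoact x) F (antipode_inv h * g) y.
Proof.
move=> hF; rewrite tsum_tsum //; apply: eq_ktsum => x h.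
rewrite tsum_tsum //; apply: eq_ktsum => g y.
by rewrite ktsum_pure.
Qed.

Lemma verma3 (V : lmodType k) (F : H -> H -> A -> V) (a : A) : trilin F ->
  \tsum_(h & x <- verma a) \tsum_(h1 & h2 <- comul h) F h1 h2 x =
  \tsum_(h & x <- verma a) \tsum_(g & y <- verma x) F h g y.
Proof.
case=> h1 h2 h3.
pose cb a := \tsum_(x & h <- rcoact a) \tsum_(g & w <- lcoact x)
  \tsum_(u & v <- comul h) \tsum_(p & q <- comul g)
    F (antipode_inv v * p) (antipode_inv u * q) w.
transitivity (cb a).
  rewrite verma_tsum; last by split; linF3 h1 h2 h3.
  apply: eq_ktsum => x h; apply: eq_ktsum => g w.
  rewrite comulM comul_antipode_inv.
  rewrite tsum_tsum; last by split; linF3 h1 h2 h3.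
  rewrite tsum_tsum; last by split; linF3 h1 h2 h3.
  apply: eq_ktsum => u v.
  rewrite ktsum_pure; last by split; linF3 h1 h2 h3.
  rewrite tsum_tsum; last by split; linF3 h1 h2 h3.
  apply: eq_ktsum => p q.
  by rewrite ktsum_pure //; split; linF3 h1 h2 h3.
rewrite verma_tsum; last by split; rewrite /verma; linF3 h1 h2 h3.
transitivity (\tsum_(x & h <- rcoact a) \tsum_(g & y <- lcoact x)
  \tsum_(z & h' <- rcoact y) \tsum_(g' & w <- lcoact z)
    F (antipode_inv h * g) (antipode_inv h' * g') w); last first.
  apply: eq_ktsum => x h; apply: eq_ktsum => g y.
  by rewrite verma_tsum //; split; linF3 h1 h2 h3.
transitivity (\tsum_(x & h <- rcoact a) \tsum_(x' & h' <- rcoact x)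
  \tsum_(g & z <- lcoact x') \tsum_(g' & w <- lcoact z)
    F (antipode_inv h * g) (antipode_inv h' * g') w); last first.
  apply: eq_ktsum => x h.
  by rewrite (@bicoact3 _ (fun g y h' => \tsum_(g' & w <- lcoact y)
     F (antipode_inv h * g) (antipode_inv h' * g') w)) //; split; linF3 h1 h2 h3.
rewrite (@rcoact3 _ (fun x' h' h => \tsum_(g & z <- lcoact x')
  \tsum_(g' & w <- lcoact z) F (antipode_inv h * g) (antipode_inv h' * g') w));
  last by split; linF3 h1 h2 h3.
apply: eq_ktsum => x h; rewrite ktsum_exchange -ktsum_exchange.
rewrite [LHS](_ : _ = \tsum_(u & v <- comul h) \tsum_(g & w <- lcoact x)
   \tsum_(p & q <- comul g) F (antipode_inv v * p) (antipode_inv u * q) w);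
  last by rewrite ktsum_exchange.
apply: eq_ktsum => u v.
by rewrite (@lcoact3 _ (fun p q w => F (antipode_inv v * p) (antipode_inv u * q) w))
  //; split; linF3 h1 h2 h3.
Qed.

Lemma verma_counit (a : A) : \tsum_(h & x <- verma a) (counit h *: x) = a.
Proof.
rewrite verma_tsum; last by split; lin.
rewrite -[RHS]rcoact_counit; apply: eq_ktsum => x h.
rewrite -[in RHS](lcoact_counit x) (ktsum_comp (fun y => counit h *: y)); last lin.
by apply: eq_ktsum => g y; rewrite rmorphM /= counit_antipode_inv scalerA.
Qed.

Lemma vermaM (a b : A) : verma (a * b) =
  \tsum_(h & x <- verma a) \tsum_(z & g <- rcoact b) \tsum_(f & y <- lcoact z)
    ((antipode_inv g * h * f) \ox (x * y)).
Proof.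
rewrite verma_tsum; last by split; lin.
rewrite /verma rcoactM tsum_tsum; last by split; lin.
apply: eq_ktsum => x h.
rewrite tsum_tsum; last by split; lin.
rewrite [RHS]ktsum_exchange; apply: eq_ktsum => z g.
rewrite ktsum_pure; last by split; lin.
rewrite lcoactM tsum_tsum; last by split; lin.
apply: eq_ktsum => e y; rewrite tsum_tsum; last by split; lin.
apply: eq_ktsum => f w; rewrite ktsum_pure; last by split; lin.
by rewrite antipode_invM !mulrA.
Qed.

Lemma verma1 : verma 1 = 1 \ox 1.
Proof.
rewrite /verma rcoact1 ktsum_pure; last by split; lin.
rewrite lcoact1 ktsum_pure; last by split; lin.
by rewrite antipode_inv1 mul1r.
Qed.

Definition coinv : {pred A} := fun a => `[< verma a = 1 \ox a >].

Lemma coinvP a : reflect (verma a = 1 \ox a) (a \in coinv).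
Proof. exact: asboolP. Qed.

Lemma verma_coinvM (b a : A) : b \in coinv ->
  verma (b * a) = \tsum_(h & x <- verma a) (h \ox (b * x)).
Proof.
move=> /coinvP hb; rewrite vermaM hb ktsum_pure; last by split; lin.
rewrite verma_tsum; last by split; lin.
by apply: eq_ktsum => x h; apply: eq_ktsum => g y; rewrite mulr1.
Qed.

Fact coinv_subalg : subalg_closed coinv.
Proof.
split.
- by apply/coinvP; rewrite verma1.
- move=> c a b /coinvP ha /coinvP hb; apply/coinvP.
  by rewrite verma_linear ha hb (lin_oxr _ (lin_id (U := A))).
- move=> a b ha /coinvP hb; apply/coinvP.
  by rewrite verma_coinvM // hb ktsum_pure //; split; lin.
Qed.

HB.instance Definition _ := GRing.isSubalgClosed.Build k A coinv coinv_subalg.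

Record coinv_alg := CoinvAlg { coinv_val :> A; _ : coinv_val \in coinv }.
HB.instance Definition _ := [isSub for coinv_val].
HB.instance Definition _ := [Choice of coinv_alg by <:].
HB.instance Definition _ := [SubChoice_isSubAlgebra of coinv_alg by <:].

Fact coinv_val_lin : linear coinv_val.
Proof. by []. Qed.
Fact coinv_val1 : coinv_val 1 = 1.
Proof. by []. Qed.
Fact coinv_valM b c : coinv_val (b * c) = coinv_val b * coinv_val c.
Proof. by []. Qed.

Fact coinv_lact_linl (a : A) : linear (fun b : coinv_alg => coinv_val b * a).
Proof. exact: lin_mull coinv_val_lin. Qed.
Fact coinv_lact_linr (b : coinv_alg) : linear (fun a : A => coinv_val b * a).
Proof. by move=> c x y; rewrite mulrDr scalerAr. Qed.
Fact coinv_lact1 (a : A) : coinv_val 1 * a = a.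
Proof. by rewrite coinv_val1 mul1r. Qed.
Fact coinv_lactA (a : A) (b c : coinv_alg) :
  coinv_val (b * c) * a = coinv_val b * (coinv_val c * a).
Proof. by rewrite coinv_valM mulrA. Qed.
Definition coinv_lmod : lmod coinv_alg :=
  LMod coinv_lact_linl coinv_lact_linr coinv_lact1 coinv_lactA.

Fact coinv_ract_linl (b : coinv_alg) : linear (fun a : A => a * coinv_val b).
Proof. by move=> c x y; rewrite mulrDl scalerAl. Qed.
Fact coinv_ract_linr (a : A) : linear (fun b : coinv_alg => a * coinv_val b).
Proof. exact: lin_mulr coinv_val_lin. Qed.
Fact coinv_ract1 (a : A) : a * coinv_val 1 = a.
Proof. by rewrite coinv_val1 mulr1. Qed.
Fact coinv_ractA (a : A) (b c : coinv_alg) :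
  a * coinv_val (b * c) = a * coinv_val b * coinv_val c.
Proof. by rewrite coinv_valM mulrA. Qed.
Definition coinv_rmod : rmod coinv_alg :=
  RMod coinv_ract_linl coinv_ract_linr coinv_ract1 coinv_ractA.

Definition canonical_map (t : tensor coinv_rmod coinv_lmod) : (H \otimes A)%type :=
  tsum t (fun a b : A => \tsum_(h & x <- verma b) (h \ox (a * x))).

Lemma canonical_map_bilinear :
  @tbilinear k coinv_alg coinv_rmod coinv_lmod _
    (fun a b : A => \tsum_(h & x <- verma b) (h \ox (a * x))).
Proof.
split=> [b|a|a b c]; [by lin|by lin|].
rewrite /= verma_coinvM; last exact: valP.
rewrite [RHS]tsum_tsum; last by split; lin.
apply: eq_ktsum => h x; rewrite ktsum_pure ?mulrA //; split; lin.
Qed.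

End QuantumYD.
Arguments yd_coact {k H A _}.

Record category := Category {
  ob :> Type;
  hom : ob -> ob -> Type;
  idm : forall X, hom X X;
  compm : forall X Y Z, hom Y Z -> hom X Y -> hom X Z;
  comp1m : forall X Y (f : hom X Y), compm (idm Y) f = f;
  compm1 : forall X Y (f : hom X Y), compm f (idm X) = f;
  compmA : forall X Y Z W (h : hom Z W) (g : hom Y Z) (f : hom X Y),
    compm h (compm g f) = compm (compm h g) f }.
Arguments idm {c} X.

Record functor (C D : category) := Functor {
  fob :> C -> D;
  fhom : forall X Y, hom X Y -> hom (fob X) (fob Y);
  fhom_id : forall X, fhom (idm X) = idm (fob X);
  fhom_comp : forall X Y Z (g : hom Y Z) (f : hom X Y),
    fhom (compm g f) = compm (fhom g) (fhom f) }.

Definition functor_id (C : category) : functor C C :=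
  @Functor C C id (fun _ _ f => f) (fun _ => erefl) (fun _ _ _ _ _ => erefl).

Section FunctorComp.
Variables (C D E : category) (G : functor D E) (F : functor C D).

Fact functor_comp_id X : fhom G (fhom F (idm X)) = idm (G (F X)).
Proof. by rewrite !fhom_id. Qed.
Fact functor_comp_comp X Y Z (g : hom Y Z) (f : hom X Y) :
  fhom G (fhom F (compm g f)) = compm (fhom G (fhom F g)) (fhom G (fhom F f)).
Proof. by rewrite !fhom_comp. Qed.

Definition functor_comp : functor C E :=
  @Functor C E (fun X => G (F X)) (fun _ _ f => fhom G (fhom F f))
    functor_comp_id functor_comp_comp.
End FunctorComp.

Definition is_iso (C : category) (X Y : C) (f : hom X Y) : Prop :=
  exists g : hom Y X, compm g f = idm X /\ compm f g = idm Y.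

Definition nat_iso (C D : category) (F G : functor C D) : Prop :=
  exists a : forall X, hom (F X) (G X),
    (forall X Y (f : hom X Y), compm (a Y) (fhom F f) = compm (fhom G f) (a X)) /\
    (forall X, is_iso (a X)).

Definition is_equivalence (C D : category) (F : functor C D) : Prop :=
  exists G : functor D C,
    nat_iso (functor_comp G F) (functor_id C) /\
    nat_iso (functor_comp F G) (functor_id D).

Section ModCategory.
Variables (k : comNzRingType) (R : algType k).

Record rmod_hom (M N : rmod R) := RModHom {
  rmod_hom_fun :> M -> N;
  rmod_hom_lin : linear rmod_hom_fun;
  rmod_hom_act : forall m r,
    rmod_hom_fun (ract m r) = ract (rmod_hom_fun m) r }.

Lemma rmod_hom_eq (M N : rmod R) (f g : rmod_hom M N) : f =1 g -> f = g.
Proof.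
case: f g => f fl fa [g gl ga] /= /funext e; subst g.
by congr RModHom; apply: Prop_irrelevance.
Qed.

Definition rmod_id (M : rmod R) : rmod_hom M M :=
  @RModHom M M id (fun _ _ _ => erefl) (fun _ _ => erefl).

Section Comp.
Variables (M N P : rmod R) (g : rmod_hom N P) (f : rmod_hom M N).
Fact rmod_comp_lin : linear (fun m => g (f m)).
Proof. exact: lin_comp (rmod_hom_lin g) (rmod_hom_lin f). Qed.
Fact rmod_comp_act m r : g (f (ract m r)) = ract (g (f m)) r.
Proof. by rewrite !rmod_hom_act. Qed.
Definition rmod_comp : rmod_hom M P := RModHom rmod_comp_lin rmod_comp_act.
End Comp.

Fact rmod_comp1m (M N : rmod R) (f : rmod_hom M N) :
  rmod_comp (rmod_id N) f = f.
Proof. exact: rmod_hom_eq. Qed.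
Fact rmod_compm1 (M N : rmod R) (f : rmod_hom M N) :
  rmod_comp f (rmod_id M) = f.
Proof. exact: rmod_hom_eq. Qed.
Fact rmod_compmA (M N P Q : rmod R) (h : rmod_hom P Q) (g : rmod_hom N P)
    (f : rmod_hom M N) :
  rmod_comp h (rmod_comp g f) = rmod_comp (rmod_comp h g) f.
Proof. exact: rmod_hom_eq. Qed.

Definition rmod_cat : category :=
  @Category (rmod R) rmod_hom rmod_id rmod_comp
    rmod_comp1m rmod_compm1 rmod_compmA.

End ModCategory.

Section YDCategory.
Variables (k : comNzRingType) (H : bijHopfAlg k) (A : bicomodAlg H).

Record ydmod_hom (M N : ydmod A) := YDModHom {
  ydmod_hom_fun :> rmod_hom M N;
  ydmod_hom_coact : forall m, yd_coact (ydmod_hom_fun m) =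
    \tsum_(h & n <- yd_coact m) (h \ox ydmod_hom_fun n) }.

Lemma ydmod_hom_eq (M N : ydmod A) (f g : ydmod_hom M N) : f =1 g -> f = g.
Proof.
case: f g => f fa [g ga] /= /rmod_hom_eq e; subst g.
by congr YDModHom; apply: Prop_irrelevance.
Qed.

Fact ydmod_id_coact (M : ydmod A) (m : M) :
  yd_coact m = \tsum_(h & n <- yd_coact m) (h \ox n).
Proof. by rewrite ktsum_id. Qed.
Definition ydmod_id (M : ydmod A) : ydmod_hom M M :=
  @YDModHom M M (rmod_id M) (@ydmod_id_coact M).

Section Comp.
Variables (M N P : ydmod A) (g : ydmod_hom N P) (f : ydmod_hom M N).
Fact ydmod_comp_coact m : yd_coact (rmod_comp g f m) =
  \tsum_(h & n <- yd_coact m) (h \ox rmod_comp g f n).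
Proof.
have lg := rmod_hom_lin g.
rewrite /= (ydmod_hom_coact g) (ydmod_hom_coact f).
rewrite tsum_tsum; last first.
  by split=> ?; [lin|apply: lin_oxr].
apply: eq_ktsum => h n; rewrite ktsum_pure //.
by split=> ?; [lin|apply: lin_oxr].
Qed.
Definition ydmod_comp : ydmod_hom M P := YDModHom ydmod_comp_coact.
End Comp.

Fact ydmod_comp1m (M N : ydmod A) (f : ydmod_hom M N) :
  ydmod_comp (ydmod_id N) f = f.
Proof. exact: ydmod_hom_eq. Qed.
Fact ydmod_compm1 (M N : ydmod A) (f : ydmod_hom M N) :
  ydmod_comp f (ydmod_id M) = f.
Proof. exact: ydmod_hom_eq. Qed.
Fact ydmod_compmA (M N P Q : ydmod A) (h : ydmod_hom P Q) (g : ydmod_hom N P)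
    (f : ydmod_hom M N) :
  ydmod_comp h (ydmod_comp g f) = ydmod_comp (ydmod_comp h g) f.
Proof. exact: ydmod_hom_eq. Qed.

Definition ydmod_cat : category :=
  @Category (ydmod A) ydmod_hom ydmod_id ydmod_comp
    ydmod_comp1m ydmod_compm1 ydmod_compmA.

Local Notation B := (coinv_alg A).

Section Induction.
Variable N : rmod B.

Let T : lmodType k := tensor N (coinv_lmod A).

Definition ind_act (t : T) (a : A) : T :=
  tsum t (fun (n : N) (x : A) => tpure n (x * a : coinv_lmod A)).

Definition ind_coact (t : T) : (H \otimes T)%type :=
  tsum t (fun (n : N) (a : A) =>
    \tsum_(h & x <- verma a) (h \ox tpure n (x : coinv_lmod A))).

Lemma ind_act_bilinear (a : A) :
  @tbilinear k B N (coinv_lmod A) T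
    (fun n x => tpure n ((x : A) * a : coinv_lmod A)).
Proof.
split=> [x|n|n b x]; first by lin.
  apply: (lin_purer (N := coinv_lmod A)) => c x y /=.
  by rewrite mulrDl scalerAl.
rewrite /= -mulrA; exact: tpure_bal.
Qed.

Lemma ind_coact_bilinear :
  @tbilinear k B N (coinv_lmod A) (H \otimes T)%type
    (fun n a => \tsum_(h & x <- verma (a : A))
       (h \ox tpure n (x : coinv_lmod A))).
Proof.
have lp (n : N) : linear (fun x : A => tpure n (x : coinv_lmod A)).
  by apply: (lin_purer (N := coinv_lmod A)).
have lh (h : H) (n : N) : linear (fun x : A => h \ox tpure n (x : coinv_lmod A)).
  by apply: lin_oxr.
split=> [a|n|n b a].
- by apply: lin_tsum_body => h x; lin.
- apply: (lin_tsum_arg (g := fun a : A => verma a)).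
  + exact: verma_linear.
  + by move=> x; lin.
  + by move=> h; apply: lh.
rewrite /= verma_coinvM; last exact: valP.
rewrite [RHS]tsum_tsum; last by split=> ?; [lin|apply: lh].
apply: eq_ktsum => h x; rewrite ktsum_pure; last by split=> ?; [lin|apply: lh].
by congr (_ \ox _); apply: tpure_bal.
Qed.

Lemma ind_act_pure n (x a : A) :
  ind_act (tpure n (x : coinv_lmod A)) a = tpure n (x * a : coinv_lmod A).
Proof. exact: (tsum_pure (ind_act_bilinear a)). Qed.

Lemma ind_coact_pure n (a : A) :
  ind_coact (tpure n (a : coinv_lmod A)) =
  \tsum_(h & x <- verma a) (h \ox tpure n (x : coinv_lmod A)).
Proof. exact: (tsum_pure ind_coact_bilinear). Qed.

Fact ind_act_linl a : linear (fun t => ind_act t a).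
Proof. exact: tsum_lin (ind_act_bilinear a). Qed.
Fact ind_act_linr t : linear (ind_act t).
Proof.
move=> c a b; move: t; apply: tensor_linear_ext.
- exact: ind_act_linl.
- move=> d x y; rewrite !ind_act_linl !scalerDr !scalerA [c * d]mulrC.
  by rewrite -!addrA; congr (_ + _); rewrite addrCA.
move=> n x; rewrite !ind_act_pure mulrDr -scalerAr.
by rewrite (tpureDr n (c *: (x * a) : coinv_lmod A)) tpureZr.
Qed.
Fact ind_act1 t : ind_act t 1 = t.
Proof.
move: t; apply: tensor_linear_ext; [exact: ind_act_linl|exact: lin_id|].
by move=> n x; rewrite ind_act_pure mulr1.
Qed.
Fact ind_actA t a b : ind_act t (a * b) = ind_act (ind_act t a) b.
Proof.
move: t; apply: tensor_linear_ext; first exact: ind_act_linl.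
  exact: lin_comp (ind_act_linl b) (ind_act_linl a).
by move=> n x; rewrite !ind_act_pure mulrA.
Qed.

Definition ind_rmod : rmod A :=
  RMod ind_act_linl ind_act_linr ind_act1 ind_actA.

Fact ind_coact_linear : linear ind_coact.
Proof. exact: tsum_lin ind_coact_bilinear. Qed.
HB.instance Definition _ :=
  GRing.isLinear.Build k T (H \otimes T)%type *:%R ind_coact ind_coact_linear.

Let lp (n : N) : linear (fun x : A => tpure n (x : coinv_lmod A)).
Proof. by apply: (lin_purer (N := coinv_lmod A)). Qed.

Lemma ind_coact_tsum (V : lmodType k) (F : H -> T -> V) n (a : A) :
  kbilinear F ->
  \tsum_(h & t <- ind_coact (tpure n (a : coinv_lmod A))) F h t =
  \tsum_(h & x <- verma a) F h (tpure n (x : coinv_lmod A)).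
Proof.
move=> hF; rewrite ind_coact_pure tsum_tsum //.
by apply: eq_ktsum => h x; rewrite ktsum_pure.
Qed.

Fact ind_coactA t :
  \tsum_(h & u <- ind_coact t) \tsum_(h1 & h2 <- comul h)
    (h1 \ox (h2 \ox u)) =
  \tsum_(h & u <- ind_coact t) \tsum_(g & v <- ind_coact u)
    (h \ox (g \ox v)).
Proof.
have lt := ind_coact_linear.
move: t; apply: tensor_linear_ext.
- by apply: (lin_tsum_arg lt); lin.
- apply: (lin_tsum_arg lt); first by lin.
  by move=> h; apply: (lin_tsum_arg lt); lin.
move=> n a; rewrite ind_coact_tsum; last by split; lin.
rewrite ind_coact_tsum; last first.
  split; first by lin.
  by move=> h; apply: (lin_tsum_arg lt); lin.
rewrite (@verma3 _ _ _ _ (fun h1 h2 x => h1 \ox (h2 \ox tpure n (x : coinv_lmod A))));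
  last first.
  split=> ? ?; [by lin|by lin|].
  by apply: lin_oxr; apply: lin_oxr; apply: lp.
by apply: eq_ktsum => h x; rewrite ind_coact_tsum //; split; lin.
Qed.

Fact ind_counit t : \tsum_(h & u <- ind_coact t) (counit h *: u) = t.
Proof.
move: t; apply: tensor_linear_ext.
- by apply: (lin_tsum_arg ind_coact_linear); lin.
- exact: lin_id.
move=> n a; rewrite ind_coact_tsum; last by split; lin.
rewrite -[in RHS](verma_counit a) (ktsum_comp _ (lp n)).
by apply: eq_ktsum => h x; rewrite (linear_scale _ _ (lp n)).
Qed.

Fact ind_compat t a : ind_coact (ind_act t a) =
  \tsum_(h & u <- ind_coact t) \tsum_(x & g <- rcoact a)
    \tsum_(f & y <- lcoact x)
      ((antipode_inv g * h * f) \ox (ind_act u y)).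
Proof.
have la h : linear (fun u : T => \tsum_(x & g <- rcoact a)
    \tsum_(f & y <- lcoact x) ((antipode_inv g * h * f) \ox (ind_act u y))).
  do 2!apply: lin_tsum_body => ? ?.
  by apply: lin_oxr; apply: ind_act_linl.
have lo h : linear (fun y : A => h \ox ind_act _ y) by move=> u; apply: lin_oxr; apply: ind_act_linr.
move: t; apply: tensor_linear_ext.
- exact: lin_comp ind_coact_linear (ind_act_linl a).
- apply: (lin_tsum_arg ind_coact_linear); last exact: la.
  by move=> u; lin.
move=> n x; rewrite ind_coact_tsum; last by split; [lin|apply: la].
rewrite ind_act_pure ind_coact_pure vermaM.
rewrite tsum_tsum; last by split=> ?; [lin|apply: lin_oxr; apply: lp].
apply: eq_ktsum => h y.
rewrite tsum_tsum; last by split=> ?; [lin|apply: lin_oxr; apply: lp].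
apply: eq_ktsum => z g.
rewrite tsum_tsum; last by split=> ?; [lin|apply: lin_oxr; apply: lp].
apply: eq_ktsum => f w; rewrite ktsum_pure ?ind_act_pure //.
by split=> ?; [lin|apply: lin_oxr; apply: lp].
Qed.

Definition ind_ydmod : ydmod A :=
  @YDMod k H A ind_rmod ind_coact ind_coactA ind_counit ind_compat.

End Induction.

Section InductionHom.
Variables (M N : rmod B) (f : rmod_hom M N).

Definition ind_map (t : tensor M (coinv_lmod A)) : tensor N (coinv_lmod A) :=
  tsum t (fun (m : M) (a : A) => tpure (f m) (a : coinv_lmod A)).

Lemma ind_map_bilinear :
  @tbilinear k B M (coinv_lmod A) _
    (fun m a => tpure (f m) (a : coinv_lmod A)).
Proof.
split=> [a|m|m b a].
- exact: lin_purel (rmod_hom_lin f).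
- by apply: (lin_purer (N := coinv_lmod A)).
- by rewrite rmod_hom_act tpure_bal.
Qed.

Lemma ind_map_pure m (a : A) :
  ind_map (tpure m (a : coinv_lmod A)) = tpure (f m) (a : coinv_lmod A).
Proof. exact: (tsum_pure ind_map_bilinear). Qed.

Fact ind_map_lin : linear ind_map.
Proof. exact: tsum_lin ind_map_bilinear. Qed.

Fact ind_map_act t a :
  ind_map (ind_act t a) = ind_act (ind_map t) a.
Proof.
move: t; apply: tensor_linear_ext.
- exact: lin_comp ind_map_lin (ind_act_linl a).
- exact: lin_comp (ind_act_linl a) ind_map_lin.
by move=> m x; rewrite ind_act_pure !ind_map_pure ind_act_pure.
Qed.

Definition ind_rmod_hom : rmod_hom (ind_ydmod M) (ind_ydmod N) :=
  @RModHom _ _ (ind_ydmod M) (ind_ydmod N) ind_map ind_map_lin ind_map_act.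

Fact ind_map_coact t : ind_coact (ind_map t) =
  \tsum_(h & u <- ind_coact t) (h \ox ind_map u).
Proof.
have lo h : linear (fun u => (h : H) \ox ind_map u).
  by apply: lin_oxr; apply: ind_map_lin.
move: t; apply: tensor_linear_ext.
- exact: lin_comp (@ind_coact_linear N) ind_map_lin.
- by apply: (lin_tsum_arg (@ind_coact_linear M)) => ?; [lin|apply: lo].
move=> m a; rewrite ind_coact_tsum; last by split=> ?; [lin|apply: lo].
rewrite ind_map_pure ind_coact_pure.
by apply: eq_ktsum => h x; rewrite ind_map_pure.
Qed.

Definition ind_hom : ydmod_hom (ind_ydmod M) (ind_ydmod N) :=
  @YDModHom (ind_ydmod M) (ind_ydmod N) ind_rmod_hom ind_map_coact.

End InductionHom.

Fact ind_hom_id (N : rmod B) : ind_hom (rmod_id N) = ydmod_id (ind_ydmod N).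
Proof.
apply: ydmod_hom_eq; apply: tensor_linear_ext.
- exact: ind_map_lin.
- exact: lin_id.
by move=> n a; apply: ind_map_pure.
Qed.

Fact ind_hom_comp (M N P : rmod B) (g : rmod_hom N P) (f : rmod_hom M N) :
  ind_hom (rmod_comp g f) = ydmod_comp (ind_hom g) (ind_hom f).
Proof.
apply: ydmod_hom_eq; apply: tensor_linear_ext.
- exact: ind_map_lin.
- exact: lin_comp (ind_map_lin g) (ind_map_lin f).
by move=> n a; rewrite /= !ind_map_pure.
Qed.

Definition induction_functor : functor (rmod_cat B) ydmod_cat :=
  @Functor (rmod_cat B) ydmod_cat ind_ydmod ind_hom ind_hom_id ind_hom_comp.

End YDCategory.

Definition projective (k : comNzRingType) (P : lmodType k) : Prop :=
  forall (X Y : lmodType k) (p : {linear X -> Y}) (f : {linear P -> Y}),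
    (forall y, exists x, p x = y) ->
    exists g : {linear P -> X}, forall u, p (g u) = f u.

(* Main.v *)
(** For M in the Yetter-Drinfel'd category, a total integral gam gives the
    H-colinear retraction h (x) m |-> m_<0> gam(h)(m_<-1>) of the coaction.
    Twisting it by A yields Phi_m : H (x) A -> M such that
    Phi_m(beta(a (x) b)) = Phi_m(1 (x) a) b, Phi_m(1 (x) a) is coinvariant, and
    the sum of Phi_{m_<0>}(m_<-1> (x) 1) is m.  The inverse of the unit
    n |-> n (x) 1 is n (x) a |-> n Phi_a(1 (x) 1), with Phi_a taken in the Verma
    module A.  As H is projective, beta has a linear section s over
    h |-> h (x) 1; writing s(h) as a sum of a_i(h) (x) b_i(h), the inverse of the
    counit m (x) a |-> m a sends m to the sum of
    Phi_{m_<0>}(1 (x) a_i(m_<-1>)) (x)_B b_i(m_<-1>). *)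

Require Import Defs.
From HB Require Import structures.
From mathcomp Require Import all_boot all_algebra.
From mathcomp Require Import boolp.

Set Implicit Arguments.
Unset Strict Implicit.
Unset Printing Implicit Defensive.

Import GRing.Theory.
Local Open Scope ring_scope.

Ltac lin_with t := intros; cbv beta; repeat (first [t | lin1]; cbv beta).

Ltac linF2 h1 h2 := lin_with ltac:(first
  [apply: (lin_comp (h1 _)) | apply: (lin_comp (h2 _))]).

(** * Convolution identities for the inverse antipode *)

Section AntipodeInvSquare.
Variables (k : comNzRingType) (H : bijHopfAlg k).
Local Notation Sinv := (@antipode_inv k H).

(** The antipode axiom transported by the algebra map [Sinv \o Sinv]. Together with [antipode_inv2r]
    it makes [Sinv] and [Sinv \o Sinv] convolution inverses of each other. *)
Lemma antipode_inv2l (h : H) :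
  \tsum_(x & y <- comul h) (Sinv x * Sinv (Sinv y)) = (counit h)%:A.
Proof.
transitivity (Sinv (Sinv (\tsum_(x & y <- comul h) (antipode x * y)))).
  rewrite (ktsum_comp (fun u => Sinv (Sinv u))); last lin.
  by apply: eq_ktsum => x y; rewrite !antipode_invM antipodeK.
by rewrite antipodel !linearZ /= !antipode_inv1.
Qed.

Lemma antipode_inv2r (h : H) :
  \tsum_(x & y <- comul h) (Sinv (Sinv x) * Sinv y) = (counit h)%:A.
Proof.
transitivity (Sinv (Sinv (\tsum_(x & y <- comul h) (x * antipode y)))).
  rewrite (ktsum_comp (fun u => Sinv (Sinv u))); last lin.
  by apply: eq_ktsum => x y; rewrite !antipode_invM antipodeK.
by rewrite antipoder !linearZ /= !antipode_inv1.
Qed.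

Lemma comul_antipode_inv2 (h : H) :
  comul (Sinv (Sinv h)) =
  \tsum_(x & y <- comul h) (Sinv (Sinv x) \ox Sinv (Sinv y)).
Proof.
rewrite comul_antipode_inv comul_antipode_inv tsum_tsum; last by split; lin.
by apply: eq_ktsum => x y; rewrite ktsum_pure //; split; lin.
Qed.

(** Coproduct of the twisting factor of [twisted_retract] at 1: the square of [Sinv] keeps the order
    of the legs, [antipode] reverses it. *)
Lemma comul_antipode_inv2M (V : lmodType k) (F : H -> H -> V) (g h : H) :
  kbilinear F ->
  \tsum_(a & b <- comul (Sinv (Sinv g) * antipode h)) F a b =
  \tsum_(p1 & p2 <- comul g) \tsum_(q1 & q2 <- comul h)
    F (Sinv (Sinv p1) * antipode q2) (Sinv (Sinv p2) * antipode q1).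
Proof.
case=> h1 h2; rewrite comulM comul_antipode_inv2 comul_antipode.
rewrite tsum_tsum //.
rewrite tsum_tsum; last first.
  split; linF2 h1 h2.
apply: eq_ktsum => p1 p2; rewrite ktsum_pure; last first.
  split; linF2 h1 h2.
rewrite tsum_tsum //; rewrite tsum_tsum; last first.
  split; linF2 h1 h2.
apply: eq_ktsum => q1 q2; rewrite ktsum_pure; last first.
  split; linF2 h1 h2.
by rewrite ktsum_pure.
Qed.

End AntipodeInvSquare.

(** * Five-leg form of the iterated bicoaction *)

Section Bicoaction.
Variables (k : comNzRingType) (H : bijHopfAlg k) (A : bicomodAlg H).

Ltac linF5 h1 h2 h3 h4 h5 := lin_with ltac:(first
  [ apply: (lin_comp (h1 _ _ _ _)) | apply: (lin_comp (h2 _ _ _ _))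
  | apply: (lin_comp (h3 _ _ _ _)) | apply: (lin_comp (h4 _ _ _ _))
  | apply: (lin_comp (h5 _ _ _ _)) ]).

(* Both sides are sums over the five legs a_<-2>, a_<-1>, a_<0>, a_<1>, a_<2>. *)
Lemma bicoact5 (V : lmodType k) (F : H -> H -> H -> H -> A -> V) (a : A) :
  (forall g g' h' y, linear (fun h => F h g g' h' y)) ->
  (forall h g' h' y, linear (fun g => F h g g' h' y)) ->
  (forall h g h' y, linear (fun g' => F h g g' h' y)) ->
  (forall h g g' y, linear (fun h' => F h g g' h' y)) ->
  (forall h g g' h', linear (F h g g' h')) ->
  \tsum_(x & h <- rcoact a) \tsum_(g & y <- lcoact x)
    \tsum_(z & h' <- rcoact y) \tsum_(g' & w <- lcoact z) F h g h' g' w =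
  \tsum_(x & h <- rcoact a) \tsum_(g & w <- lcoact x)
    \tsum_(u & v <- comul h) \tsum_(p & q <- comul g) F v p u q w.
Proof.
move=> h1 h2 h3 h4 h5.
(* The bicomodule law makes the two right coactions adjacent, and the two left ones; coassociativity
   then applies on each side. *)
transitivity (\tsum_(x & h <- rcoact a) \tsum_(x' & h' <- rcoact x)
  \tsum_(g & z <- lcoact x') \tsum_(g' & w <- lcoact z) F h g h' g' w).
  apply: eq_ktsum => x h.
  by rewrite (@bicoact3 _ _ _ _ (fun g y h' =>
    \tsum_(g' & w <- lcoact y) F h g h' g' w)) //; split; linF5 h1 h2 h3 h4 h5.
rewrite (@rcoact3 _ _ _ _ (fun x' h' h => \tsum_(g & z <- lcoact x')
  \tsum_(g' & w <- lcoact z) F h g h' g' w));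
  last by split; linF5 h1 h2 h3 h4 h5.
apply: eq_ktsum => x h; rewrite [RHS]ktsum_exchange; apply: eq_ktsum => u v.
by rewrite (@lcoact3 _ _ _ _ (fun p q w => F v p u q w)) //;
  split; linF5 h1 h2 h3 h4 h5.
Qed.

End Bicoaction.

(** * The retraction defined by a total integral, and its twist *)

Section Integral.
Variables (k : comNzRingType) (H : bijHopfAlg k) (A : bicomodAlg H).
Variable gam : H -> {linear H -> A}.
Hypotheses (gam_int : quantum_integral gam) (gam_total : total_integral gam).
Local Notation Sinv := (@antipode_inv k H).

Lemma integral_linl (h : H) : linear (fun g => gam g h).
Proof. by move=> c x y; have [+ _] := gam_int; apply. Qed.

Section Average.
Variable M : ydmod A.

Lemma yd_coact3 (V : lmodType k) (F : H -> H -> M -> V) (m : M) : trilin F ->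
  \tsum_(h & n <- yd_coact m) \tsum_(h1 & h2 <- comul h) F h1 h2 n =
  \tsum_(h & n <- yd_coact m) \tsum_(g & p <- yd_coact n) F h g p.
Proof.
move=> hF; have := congr1 (ev3 F) (yd_coactA m); rewrite !ev3_tsum // => e.
rewrite -(eq_ktsum _ (fun x y => ev3_tsum2 _ _ _ _ hF)) e.
by apply: eq_ktsum => x y; rewrite ev3_tsum2.
Qed.

(* The H-colinear retraction of the coaction M -> H \otimes M. *)
Definition coact_retract (h : H) (m : M) : M :=
  \tsum_(g & n <- yd_coact m) ract n (gam h g).

Lemma coact_retract_linl m : linear (fun h => coact_retract h m).
Proof.
rewrite /coact_retract; apply: lin_tsum_body => g n.
by apply: lin_ractr; apply: integral_linl.
Qed.

Lemma coact_retract_linr h : linear (coact_retract h).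
Proof. by rewrite /coact_retract; lin. Qed.

Ltac linR := lin_with ltac:(first
  [ apply: (lin_comp (@coact_retract_linl _))
  | apply: (lin_comp (@coact_retract_linr _))
  | apply: (lin_comp (integral_linl _)) ]).

(** By coassociativity the two arguments of [gam] become the legs of one coproduct, where totality
    applies. *)
Lemma coact_retractK m :
  \tsum_(h & n <- yd_coact m) coact_retract h n = m.
Proof.
rewrite /coact_retract -(@yd_coact3 _ (fun h g n => ract n (gam h g)));
  last by split; linR.
rewrite -[RHS]yd_counit; apply: eq_ktsum => h n.
rewrite -(ktsum_comp (fun a => ract n a)); last lin.
by rewrite gam_total ract_scalar.
Qed.

(** Yetter-Drinfel'd compatibility followed by coassociativity produces exactly the right side of
    the quantum integral identity, with the leg [g] of the coaction of [m] as second argument of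
    [gam]. *)
Lemma coact_retract_coact h m :
  yd_coact (coact_retract h m) =
  \tsum_(h1 & h2 <- comul h) (h1 \ox coact_retract h2 m).
Proof.
rewrite /coact_retract (ktsum_comp yd_coact); last lin.
under eq_ktsum => g n do rewrite yd_compat.
rewrite -(@yd_coact3 _ (fun g g' n => \tsum_(x & f <- rcoact (gam h g))
   \tsum_(e & y <- lcoact x) ((Sinv f * g' * e) \ox ract n y)));
  last by split; linR.
transitivity (\tsum_(g & n <- yd_coact m) \tsum_(h1 & h2 <- comul h)
    (h1 \ox ract n (gam h2 g))).
  apply: eq_ktsum => g n; have [_ gi] := gam_int.
  have bn : kbilinear (fun (x : H) (a : A) => x \ox ract n a) by split; lin.
  (* The integral identity lives in [H \otimes A]; letting the second factor act on [n] moves it to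
     [H \otimes M]. *)
  have := congr1 (fun t => ktsum t (fun x a => x \ox ract n a)) (gi h g).
  rewrite tsum_tsum // => e.
  transitivity (\tsum_(g1 & g2 <- comul h)
    \tsum_(x & a <- (g1 \ox gam g2 g)) (x \ox ract n a)); last first.
    by apply: eq_ktsum => h1 h2; rewrite ktsum_pure.
  rewrite e tsum_tsum //; apply: eq_ktsum => h1 h2.
  rewrite tsum_tsum //; apply: eq_ktsum => x f.
  rewrite tsum_tsum //; apply: eq_ktsum => z y.
  by rewrite ktsum_pure.
rewrite ktsum_exchange; apply: eq_ktsum => h1 h2.
by rewrite (ktsum_comp (fun u => h1 \ox u)) //; lin.
Qed.

(* The twist by a undoes the canonical map, see [twisted_retract_verma]. *)
Definition twisted_retract (m : M) (h : H) (a : A) : M :=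
  \tsum_(x & g <- rcoact a) \tsum_(f & y <- lcoact x)
    ract (coact_retract (Sinv (Sinv g) * h * antipode f) m) y.

Lemma twisted_retract_linm h a : linear (fun m => twisted_retract m h a).
Proof. by rewrite /twisted_retract; linR. Qed.
Lemma twisted_retract_linh m a : linear (fun h => twisted_retract m h a).
Proof. by rewrite /twisted_retract; linR. Qed.
Lemma twisted_retract_lina m h : linear (twisted_retract m h).
Proof. by rewrite /twisted_retract; linR. Qed.

Lemma twisted_retract1 m h : twisted_retract m h 1 = coact_retract h m.
Proof.
rewrite /twisted_retract rcoact1 ktsum_pure; last by split; linR.
rewrite lcoact1 ktsum_pure; last by split; linR.
by rewrite !antipode_inv1 antipode1 mul1r mulr1 ract1.
Qed.

(** In five-leg form the legs of [b] contribute [Sinv (Sinv u) * Sinv v] and [p * antipode q] to the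
    argument of the retraction. Both collapse to counits, and only the action of [b] remains. *)
Lemma twisted_retract_verma m a b :
  \tsum_(h & x <- verma b) twisted_retract m h (a * x) =
  ract (twisted_retract m 1 a) b.
Proof.
rewrite verma_tsum; last first.
  by split; [|move=> h]; rewrite /twisted_retract; linR.
rewrite /twisted_retract.
(* Multiplicativity of the coactions separates the legs of [b] from those of [a]. *)
transitivity (\tsum_(x & h <- rcoact b) \tsum_(g & y <- lcoact x)
  \tsum_(z & h' <- rcoact y) \tsum_(g' & w <- lcoact z)
  \tsum_(a0 & r <- rcoact a) \tsum_(l & a1 <- lcoact a0)
    ract (coact_retract
      (Sinv (Sinv (r * h')) * (Sinv h * g) * antipode (l * g')) m) (a1 * w)).
  apply: eq_ktsum => x h; apply: eq_ktsum => g y.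
  rewrite rcoactM tsum_tsum; last by split; linR.
  under eq_ktsum => a0 r.
    rewrite tsum_tsum; last by split; linR.
    under eq_ktsum => z h'.
      rewrite ktsum_pure; last by split; linR.
      rewrite lcoactM tsum_tsum; last by split; linR.
      under eq_ktsum => l a1.
        rewrite tsum_tsum; last by split; linR.
        under eq_ktsum => g' w.
          rewrite ktsum_pure; last by split; linR.
          over.
        over.
      rewrite ktsum_exchange.
      over.
    over.
  rewrite ktsum_exchange; apply: eq_ktsum => z h'.
  by rewrite ktsum_exchange.
rewrite (@bicoact5 _ _ _ _ (fun h g h' g' w =>
  \tsum_(a0 & r <- rcoact a) \tsum_(l & a1 <- lcoact a0)
    ract (coact_retract
      (Sinv (Sinv (r * h')) * (Sinv h * g) * antipode (l * g')) m) (a1 * w)));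
  try by linR.
(* The outer legs of [b] enter only through [u], as the product that collapses; [w] is the middle
   leg. *)
pose psi w u := \tsum_(a0 & r <- rcoact a) \tsum_(l & a1 <- lcoact a0)
  ract (coact_retract (Sinv (Sinv r) * u * antipode l) m) (a1 * w).
have psi_lin w : linear (psi w) by rewrite /psi; linR.
transitivity (\tsum_(x & h <- rcoact b) \tsum_(g & w <- lcoact x)
  (counit h * counit g) *: psi w 1).
  apply: eq_ktsum => x h; apply: eq_ktsum => g w.
  rewrite -(linear_scale _ _ (psi_lin w)) -scalerA.
  have -> : counit h *: (counit g *: 1) = (counit h)%:A * (counit g)%:A :> H.
    by rewrite -scalerAl mul1r.
  rewrite -antipode_inv2r -antipoder.
  rewrite (ktsum_comp (fun z => psi w (z * _))); last first.
    by apply: (lin_comp (psi_lin w)); lin.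
  apply: eq_ktsum => u v.
  rewrite (ktsum_comp (fun z => psi w (_ * z))); last first.
    by apply: (lin_comp (psi_lin w)); lin.
  apply: eq_ktsum => p q; apply: eq_ktsum => a0 r; apply: eq_ktsum => l a1.
  by rewrite !antipode_invM antipodeM !mulrA.
rewrite -[in RHS](rcoact_counit b) (ktsum_comp (fun x => ract _ x)); last lin.
apply: eq_ktsum => x h.
rewrite -[in RHS](lcoact_counit x) (ktsum_comp (fun x => ract _ (_ *: x))); last lin.
apply: eq_ktsum => g w.
rewrite scalerA [RHS](linear_scale _ _ (ract_linr _)); congr (_ *: _).
rewrite (ktsum_comp (fun u => ract u w)); last lin.
apply: eq_ktsum => a0 r.
rewrite (ktsum_comp (fun u => ract u w)); last lin.
by apply: eq_ktsum => l a1; rewrite ractA.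
Qed.

(** The [H]-factor of the coaction collects [Sinv u1 * Sinv (Sinv u2)] and [antipode q1 * q2], which
    are both counits, so it reduces to 1. *)
Lemma twisted_retract_coact m a :
  yd_coact (twisted_retract m 1 a) = 1 \ox twisted_retract m 1 a.
Proof.
rewrite /twisted_retract (ktsum_comp yd_coact); last lin.
transitivity (\tsum_(x & h <- rcoact a) \tsum_(g & y <- lcoact x)
  \tsum_(z & h' <- rcoact y) \tsum_(g' & w <- lcoact z)
  \tsum_(p1 & p2 <- comul h) \tsum_(q1 & q2 <- comul g)
    ((Sinv h' * (Sinv (Sinv p1) * antipode q2) * g') \ox
     ract (coact_retract (Sinv (Sinv p2) * antipode q1) m) w)).
  apply: eq_ktsum => x h; rewrite (ktsum_comp yd_coact); last lin.
  apply: eq_ktsum => g y; rewrite mulr1 yd_compat coact_retract_coact.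
  rewrite tsum_tsum; last by split; linR.
  rewrite comul_antipode_inv2M; last by split; linR.
  transitivity (\tsum_(p1 & p2 <- comul h) \tsum_(q1 & q2 <- comul g)
    \tsum_(z & h' <- rcoact y) \tsum_(g' & w <- lcoact z)
    ((Sinv h' * (Sinv (Sinv p1) * antipode q2) * g') \ox
     ract (coact_retract (Sinv (Sinv p2) * antipode q1) m) w)).
    apply: eq_ktsum => p1 p2; apply: eq_ktsum => q1 q2.
    by rewrite ktsum_pure //; split; linR.
  under eq_ktsum => p1 p2 do rewrite ktsum_exchange.
  rewrite ktsum_exchange; apply: eq_ktsum => z h'.
  under eq_ktsum => p1 p2 do rewrite ktsum_exchange.
  by rewrite ktsum_exchange.
rewrite (@bicoact5 _ _ _ _ (fun h g h' g' w =>
  \tsum_(p1 & p2 <- comul h) \tsum_(q1 & q2 <- comul g)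
    ((Sinv h' * (Sinv (Sinv p1) * antipode q2) * g') \ox
     ract (coact_retract (Sinv (Sinv p2) * antipode q1) m) w)));
  try by linR.
rewrite [RHS](ktsum_comp (fun u => 1 \ox u)); last lin.
apply: eq_ktsum => x h.
rewrite [RHS](ktsum_comp (fun u => 1 \ox u)); last lin.
apply: eq_ktsum => g w.
pose R v p := ract (coact_retract (Sinv (Sinv v) * 1 * antipode p) m) w.
have Rl p : linear (R^~ p) by rewrite /R; linR.
have Rr v : linear (R v) by rewrite /R; linR.
(* Coassociativity on both sides groups the legs that land in the left tensor factor; [v] and [p]
   stay inside the retraction. *)
transitivity (\tsum_(u & v <- comul h) \tsum_(u1 & u2 <- comul u)
  \tsum_(p & q <- comul g) \tsum_(q1 & q2 <- comul q)
    (((Sinv u1 * Sinv (Sinv u2)) * (antipode q1 * q2)) \ox R v p)).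
  rewrite (@comul3 _ _ _ (fun u1 u2 v => \tsum_(p & q <- comul g)
     \tsum_(q1 & q2 <- comul q)
    (((Sinv u1 * Sinv (Sinv u2)) * (antipode q1 * q2)) \ox R v p)));
    last by rewrite /R; split; linR.
  apply: eq_ktsum => u v; rewrite ktsum_exchange; apply: eq_ktsum => p1 p2.
  rewrite (@comul3 _ _ _ (fun q1 q2 q =>
    ((Sinv u * (Sinv (Sinv p1) * antipode q2) * q) \ox
     ract (coact_retract (Sinv (Sinv p2) * antipode q1) m) w)));
    last by split; linR.
  apply: eq_ktsum => p q; apply: eq_ktsum => q1 q2.
  by rewrite /R mulr1 !mulrA.
rewrite -/(R h g) -[in RHS](counitl h).
rewrite [RHS](ktsum_comp (fun v => 1 \ox R v g)); last first.
  exact: lin_oxr (Rl g).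
apply: eq_ktsum => u v.
rewrite -[in RHS](counitr g).
rewrite [RHS](ktsum_comp (fun p => 1 \ox R (counit u *: v) p)); last first.
  exact: lin_oxr (Rr _).
under eq_ktsum => u1 u2.
  under eq_ktsum => p q.
    rewrite -(ktsum_comp (fun z => (_ * z) \ox R v p)); last lin.
    rewrite antipodel.
    over.
  over.
rewrite ktsum_exchange; apply: eq_ktsum => p q.
rewrite -(ktsum_comp (fun z => (z * _) \ox R v p)); last lin.
rewrite antipode_inv2l (linear_scale _ _ (Rl _)) (linear_scale _ _ (Rr _)).
by rewrite -scalerAl mul1r /ktensor !tpureZl
  !(@tpureZr k k^o (base_rmod H) (base_lmod M)).
Qed.

End Average.

Lemma twisted_retract_canonical (M : ydmod A) (m : M) t :
  \tsum_(h & x <- canonical_map t) twisted_retract m h x =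
  tsum t (fun a b : A => ract (twisted_retract m 1 a) b).
Proof.
have bF : kbilinear (twisted_retract m).
  by split=> [a|h]; [apply: twisted_retract_linh|apply: twisted_retract_lina].
rewrite /canonical_map (tsum_comp _ _ (ktsum_lin bF)).
apply: eq_tsum => a b; rewrite -twisted_retract_verma tsum_tsum //.
by apply: eq_ktsum => h x; rewrite ktsum_pure.
Qed.

(** Only the action and the coaction of the module enter the formula, hence naturality. It will be
    used along morphisms out of the Verma module. *)
Lemma twisted_retract_hom (M N : ydmod A) (f : ydmod_hom M N) m h a :
  f (twisted_retract m h a) = twisted_retract (f m) h a.
Proof.
have lf := rmod_hom_lin f.
rewrite /twisted_retract (ktsum_comp _ lf); apply: eq_ktsum => x g.
rewrite (ktsum_comp _ lf); apply: eq_ktsum => l y.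
rewrite rmod_hom_act /coact_retract (ktsum_comp _ lf) ydmod_hom_coact.
rewrite tsum_tsum; last by split; lin.
congr (ract _ _); apply: eq_ktsum => p n.
by rewrite ktsum_pure ?rmod_hom_act //; split; lin.
Qed.

End Integral.

(** * Natural isomorphisms and bijective morphisms *)

Section NatIso.
Variables (C D : category) (F G : functor C D).

(** The unit of the adjunction starts at the identity functor, whereas [is_equivalence] asks for an
    isomorphism ending there. *)
Lemma nat_iso_sym : nat_iso F G -> nat_iso G F.
Proof.
case=> a [na ia]; exists (fun X => projT1 (cid (ia X))); split=> [X Y f|X].
  case: cid => b [/= ba _]; case: cid => b' [/= _ ab'].
  rewrite -[LHS]compm1 -ab' -compmA (compmA _ (a X)) -na.
  by rewrite !compmA ba comp1m.
by case: cid => b [/= ba ab]; exists (a X).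
Qed.

End NatIso.

Lemma linear_can (k : comNzRingType) (U V : lmodType k) (f : U -> V) g :
  linear f -> cancel f g -> cancel g f -> linear g.
Proof. by move=> lf fK gK c x y; rewrite -{1}(gK x) -{1}(gK y) -lf fK. Qed.

Lemma rmod_bij_iso (k : comNzRingType) (R : algType k) (M N : rmod R)
    (f : rmod_hom M N) :
  bijective f -> @is_iso (rmod_cat R) M N f.
Proof.
case=> g fK gK.
have gl : linear g := linear_can (rmod_hom_lin f) fK gK.
have ga n r : g (ract n r) = ract (g n) r.
  by rewrite -{1}(gK n) -rmod_hom_act fK.
by exists (RModHom gl ga); split; apply: rmod_hom_eq.
Qed.

Section Coinvariants.
Variables (k : comNzRingType) (H : bijHopfAlg k) (A : bicomodAlg H).
Local Notation B := (coinv_alg A).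

Lemma ydmod_bij_iso (M N : ydmod A) (f : ydmod_hom M N) :
  bijective f -> @is_iso (ydmod_cat A) M N f.
Proof.
move=> /[dup] /rmod_bij_iso [g [gf fg]] _.
have fK m : g (f m) = m by apply: (congr1 (fun u : rmod_hom M M => u m) gf).
have gK n : f (g n) = n by apply: (congr1 (fun u : rmod_hom N N => u n) fg).
have lg := rmod_hom_lin g.
have gc n : yd_coact (g n) = \tsum_(h & x <- yd_coact n) (h \ox g x).
  rewrite -{2}(gK n) ydmod_hom_coact tsum_tsum; last by split; lin.
  rewrite -[LHS]ktsum_id; apply: eq_ktsum => h x.
  by rewrite ktsum_pure ?fK //; split; lin.
by exists (YDModHom gc); split; apply: ydmod_hom_eq.
Qed.

(** * The coinvariants functor *)

Section CoinvariantModule.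
Variable M : ydmod A.

Definition yd_coinv : {pred M} := fun m => `[< yd_coact m = 1 \ox m >].

Lemma yd_coinvP m : reflect (yd_coact m = 1 \ox m) (m \in yd_coinv).
Proof. exact: asboolP. Qed.

(** With [m] contributing only 1 to the left factor, the compatibility formula reduces to the Verma
    coaction of [a]. *)
Lemma coact_ract_coinv m a : m \in yd_coinv ->
  yd_coact (ract m a) = \tsum_(h & x <- verma a) (h \ox ract m x).
Proof.
move=> /yd_coinvP hm; rewrite yd_compat hm ktsum_pure; last by split; lin.
rewrite verma_tsum; last by split; lin.
by apply: eq_ktsum => x h; apply: eq_ktsum => g y; rewrite mulr1.
Qed.

Lemma ract_coinv m (b : B) : m \in yd_coinv -> ract m b \in yd_coinv.
Proof.
move=> hm; apply/yd_coinvP; rewrite coact_ract_coinv //.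
rewrite (coinvP _ (valP b)) ktsum_pure //; split; lin.
Qed.

Fact yd_coinv_submod : submod_closed yd_coinv.
Proof.
split.
  by apply/yd_coinvP; rewrite linear0 (linear_zero (lin_oxr _ (lin_id (U := M)))).
move=> c x y /yd_coinvP hx /yd_coinvP hy; apply/yd_coinvP.
by rewrite linearP hx hy (lin_oxr _ (lin_id (U := M))).
Qed.

HB.instance Definition _ :=
  GRing.isSubmodClosed.Build k M yd_coinv yd_coinv_submod.

Record coinv_mod := CoinvMod {
  coinv_mod_val :> M; _ : coinv_mod_val \in yd_coinv }.
HB.instance Definition _ := [isSub for coinv_mod_val].
HB.instance Definition _ := [Choice of coinv_mod by <:].
HB.instance Definition _ := [SubChoice_isSubLmodule of coinv_mod by <:].

Fact coinv_mod_val_lin : linear coinv_mod_val. Proof. by []. Qed.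

Definition coinv_act (m : coinv_mod) (b : B) : coinv_mod :=
  CoinvMod (ract_coinv b (valP m)).

Fact coinv_act_linl b : linear (coinv_act^~ b).
Proof. by move=> c x y; apply: val_inj; rewrite /= ract_linl. Qed.
Fact coinv_act_linr m : linear (coinv_act m).
Proof. by move=> c x y; apply: val_inj; rewrite /= ract_linr. Qed.
Fact coinv_act1 m : coinv_act m 1 = m.
Proof. by apply: val_inj; rewrite /= ract1. Qed.
Fact coinv_actA m b c : coinv_act m (b * c) = coinv_act (coinv_act m b) c.
Proof. by apply: val_inj; rewrite /= ractA. Qed.

Definition coinv_mod_rmod : rmod B :=
  RMod coinv_act_linl coinv_act_linr coinv_act1 coinv_actA.

End CoinvariantModule.

Section CoinvariantHom.
Variables (M N : ydmod A) (f : ydmod_hom M N).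

Fact coinv_hom_subproof (m : coinv_mod M) : f m \in @yd_coinv N.
Proof.
apply/yd_coinvP; rewrite ydmod_hom_coact (yd_coinvP _ (valP m)).
have lf := rmod_hom_lin f.
by rewrite ktsum_pure //; split; lin.
Qed.

Definition coinv_map (m : coinv_mod M) : coinv_mod N :=
  CoinvMod (coinv_hom_subproof m).

Fact coinv_map_lin : linear coinv_map.
Proof. by move=> c x y; apply: val_inj; rewrite /= rmod_hom_lin. Qed.
Fact coinv_map_act m (b : B) :
  coinv_map (coinv_act m b) = coinv_act (coinv_map m) b.
Proof. by apply: val_inj; rewrite /= rmod_hom_act. Qed.

Definition coinv_hom : rmod_hom (coinv_mod_rmod M) (coinv_mod_rmod N) :=
  @RModHom _ _ (coinv_mod_rmod M) (coinv_mod_rmod N) coinv_map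
    coinv_map_lin coinv_map_act.

End CoinvariantHom.

Fact coinv_hom_id (M : ydmod A) :
  coinv_hom (ydmod_id M) = rmod_id (coinv_mod_rmod M).
Proof. by apply: rmod_hom_eq => m; apply: val_inj. Qed.
Fact coinv_hom_comp (M N P : ydmod A) (g : ydmod_hom N P) (f : ydmod_hom M N) :
  coinv_hom (ydmod_comp g f) = rmod_comp (coinv_hom g) (coinv_hom f).
Proof. by apply: rmod_hom_eq => m; apply: val_inj. Qed.

Definition coinv_functor : functor (ydmod_cat A) (rmod_cat B) :=
  @Functor (ydmod_cat A) (rmod_cat B) coinv_mod_rmod coinv_hom
    coinv_hom_id coinv_hom_comp.

(** * The Verma module and the orbit maps of coinvariants *)

Definition verma_rmod : rmod A :=
  @RMod k A A *%R (fun r => lin_mull r (lin_id (U := A)))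
    (fun m => lin_mulr m (lin_id (U := A))) (@mulr1 A) (@mulrA A).

Fact verma_coactA (a : A) :
  \tsum_(h & x <- verma a) \tsum_(h1 & h2 <- comul h) (h1 \ox (h2 \ox x)) =
  \tsum_(h & x <- verma a) \tsum_(g & y <- verma x) (h \ox (g \ox y)).
Proof.
by rewrite (@verma3 _ _ _ _ (fun h1 h2 x => h1 \ox (h2 \ox x))) //; split; lin.
Qed.

Definition verma_ydmod : ydmod A :=
  @YDMod k H A verma_rmod (@verma k H A) verma_coactA
    (@verma_counit k H A) (@vermaM k H A).

Section Orbit.
Variables (M : ydmod A) (m : M) (hm : m \in @yd_coinv M).

Definition orbit_rmod_hom : rmod_hom verma_ydmod M :=
  @RModHom _ _ verma_ydmod M (ract m) (ract_linr m) (ractA m).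

(** Naturality of [twisted_retract] along this morphism carries computations in [A] over to [M]. *)
Definition orbit_hom : ydmod_hom verma_ydmod M :=
  @YDModHom k H A verma_ydmod M orbit_rmod_hom (fun a => coact_ract_coinv a hm).

End Orbit.

(** * Unit and counit of induction and coinvariants *)

Section Unit.
Variable N : rmod B.

Fact ind_unit_subproof (n : N) :
  tpure n (1 : coinv_lmod A) \in @yd_coinv (ind_ydmod N).
Proof.
apply/yd_coinvP; rewrite [LHS]ind_coact_pure verma1 ktsum_pure //.
by split; lin; apply: (lin_purer (N := coinv_lmod A)).
Qed.

Definition ind_unit_map (n : N) : coinv_mod (ind_ydmod N) :=
  CoinvMod (ind_unit_subproof n).

Fact ind_unit_lin : linear ind_unit_map.
Proof.
by move=> c x y; apply: val_inj; apply: (lin_purel _ (lin_id (U := N))).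
Qed.
Fact ind_unit_act n (b : B) :
  ind_unit_map (ract n b) = coinv_act (ind_unit_map n) b.
Proof.
apply: val_inj; rewrite /= ind_act_pure mul1r tpure_bal.
by congr tpure; rewrite /= mulr1.
Qed.

Definition ind_unit : rmod_hom N (coinv_mod_rmod (ind_ydmod N)) :=
  @RModHom _ _ N (coinv_mod_rmod (ind_ydmod N)) ind_unit_map
    ind_unit_lin ind_unit_act.

End Unit.

Section Counit.
Variable M : ydmod A.
Local Notation T := (tensor (coinv_mod_rmod M) (coinv_lmod A)).

Definition ind_counit_map (t : T) : M :=
  tsum t (fun (m : coinv_mod M) (a : A) => ract (m : M) a).

Lemma ind_counit_bilinear :
  @tbilinear k B (coinv_mod_rmod M) (coinv_lmod A) M
    (fun (m : coinv_mod M) (a : A) => ract (m : M) a).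
Proof.
split=> [a|m|m b a].
- by move=> c x y; rewrite /= ract_linl.
- exact: ract_linr.
- by rewrite /= ractA.
Qed.

Lemma ind_counit_pure (m : coinv_mod M) (a : A) :
  ind_counit_map (tpure (m : coinv_mod_rmod M) (a : coinv_lmod A)) =
  ract (m : M) a.
Proof. exact: (tsum_pure ind_counit_bilinear). Qed.

Fact ind_counit_lin : linear ind_counit_map.
Proof. exact: tsum_lin ind_counit_bilinear. Qed.

Fact ind_counit_act t a :
  ind_counit_map (ind_act t a) = ract (ind_counit_map t) a.
Proof.
move: t; apply: tensor_linear_ext.
- exact: lin_comp ind_counit_lin (ind_act_linl a).
- exact: lin_comp (ract_linl a) ind_counit_lin.
by move=> m x; rewrite ind_act_pure !ind_counit_pure ractA.
Qed.

Definition ind_counit_rmod_hom : rmod_hom (ind_ydmod (coinv_mod_rmod M)) M :=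
  @RModHom _ _ (ind_ydmod (coinv_mod_rmod M)) M ind_counit_map
    ind_counit_lin ind_counit_act.

Fact ind_counit_coact t : yd_coact (ind_counit_map t) =
  \tsum_(h & u <- ind_coact t) (h \ox ind_counit_map u).
Proof.
have lc := ind_counit_lin.
have bo : kbilinear (fun (h : H) u => h \ox ind_counit_map u).
  by split=> ?; [lin|apply: lin_oxr].
move: t; apply: tensor_linear_ext.
- by apply: (lin_comp (f := yd_coact)) => //; lin.
- by case: bo => ? ?; apply: (lin_tsum_arg (@ind_coact_linear _ _ _ _)).
move=> m a; rewrite ind_coact_tsum // ind_counit_pure.
rewrite coact_ract_coinv; last exact: valP.
by apply: eq_ktsum => h x; rewrite ind_counit_pure.
Qed.

Definition ind_counit_hom : ydmod_hom (ind_ydmod (coinv_mod_rmod M)) M :=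
  @YDModHom _ _ _ (ind_ydmod (coinv_mod_rmod M)) M ind_counit_rmod_hom
    ind_counit_coact.

End Counit.

Lemma ind_unit_nat (M N : rmod B) (f : rmod_hom M N) :
  rmod_comp (ind_unit N) f = rmod_comp (coinv_hom (ind_hom f)) (ind_unit M).
Proof.
apply: rmod_hom_eq => m; apply: val_inj.
by rewrite /= ind_map_pure.
Qed.

Lemma ind_counit_nat (M N : ydmod A) (f : ydmod_hom M N) :
  ydmod_comp (ind_counit_hom N) (ind_hom (coinv_hom f)) =
  ydmod_comp f (ind_counit_hom M).
Proof.
apply: ydmod_hom_eq; apply: tensor_linear_ext.
- exact: lin_comp (@ind_counit_lin N) (ind_map_lin _).
- exact: lin_comp (rmod_hom_lin f) (@ind_counit_lin M).
move=> m a; rewrite /= ind_map_pure !ind_counit_pure.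
by rewrite rmod_hom_act.
Qed.

End Coinvariants.

(** * Projection onto coinvariants and inverse of the unit *)

Section Equivalence.
Variables (k : comNzRingType) (H : bijHopfAlg k) (A : bicomodAlg H).
Local Notation B := (coinv_alg A).
Variable gam : H -> {linear H -> A}.
Hypotheses (gam_int : quantum_integral gam) (gam_total : total_integral gam).

Lemma integral1 : gam 1 1 = 1.
Proof.
have := gam_total 1; rewrite comul1 rmorph1 scale1r ktsum_pure //.
by split=> h; [apply: integral_linl|lin].
Qed.

Lemma twisted_retract_coinv (M : ydmod A) (m : M) a :
  twisted_retract gam m 1 a \in @yd_coinv _ _ _ M.
Proof. by apply/yd_coinvP; apply: twisted_retract_coact. Qed.

(** With [twisted_retract_coinv], this makes [twisted_retract gam m 1 1] a projection of [M] onto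
    its coinvariants. *)
Lemma twisted_retract_id (M : ydmod A) (m : M) :
  m \in @yd_coinv _ _ _ M -> twisted_retract gam m 1 1 = m.
Proof.
move=> /yd_coinvP hm; rewrite twisted_retract1 // /coact_retract hm.
by rewrite ktsum_pure ?integral1 ?ract1 //; split; lin.
Qed.

(** The projection just obtained, for the Verma module: by [verma_traceM] and [verma_trace1] it is a
    left [B]-linear retraction of the inclusion of [B] in [A]. *)
Definition verma_trace (a : A) : B :=
  CoinvAlg (twisted_retract_coinv (M := verma_ydmod A) a 1).

Lemma verma_trace_lin : linear verma_trace.
Proof.
move=> c x y; apply: val_inj.
exact: (twisted_retract_linm gam (M := verma_ydmod A)).
Qed.

(** Left multiplication by a coinvariant [b] is an orbit map of the Verma module, so naturality
    applies. *)
Lemma verma_traceM (b : B) a : verma_trace (coinv_val b * a) = b * verma_trace a.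
Proof.
apply: val_inj; symmetry.
exact: (twisted_retract_hom gam (orbit_hom (M := verma_ydmod A) (valP b)) a 1 1).
Qed.

Lemma verma_trace1 : verma_trace 1 = 1.
Proof.
apply: val_inj; apply: (twisted_retract_id (M := verma_ydmod A)).
by apply/yd_coinvP; apply: verma1.
Qed.

Section UnitInverse.
Variable N : rmod B.

Definition ind_unit_inv (t : tensor N (coinv_lmod A)) : N :=
  tsum t (fun (n : N) (a : A) => ract n (verma_trace a)).

Lemma ind_unit_inv_bilinear :
  @tbilinear k B N (coinv_lmod A) N (fun n (a : A) => ract n (verma_trace a)).
Proof.
split=> [a|n|n b a].
- exact: ract_linl.
- exact: lin_comp (ract_linr n) verma_trace_lin.
- by rewrite /= verma_traceM ractA.
Qed.

(** A pure tensor of [n] and [a] is the image of [a] under the orbit map of the coinvariant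
    [tpure n 1]. Naturality reduces the projection to [verma_trace a], which crosses the tensor
    product over [B]. *)
Lemma twisted_retract_ind (t : ind_ydmod N) :
  twisted_retract gam t 1 1 = tpure (ind_unit_inv t) (1 : coinv_lmod A).
Proof.
move: t; apply: tensor_linear_ext.
- exact: (twisted_retract_linm gam (M := ind_ydmod N)).
- exact: lin_purel (tsum_lin ind_unit_inv_bilinear).
move=> n a.
rewrite /ind_unit_inv (tsum_pure ind_unit_inv_bilinear) tpure_bal /= mulr1.
have oE (x : A) :
    orbit_hom (valP (ind_unit N n)) x = tpure n (x : coinv_lmod A).
  by rewrite /= ind_act_pure mul1r.
by rewrite -oE -twisted_retract_hom oE.
Qed.

Lemma ind_unit_bij : bijective (ind_unit N).
Proof.
exists (fun t : coinv_mod (ind_ydmod N) =>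
  ind_unit_inv (t : ind_ydmod N)) => [n|t].
  by rewrite /ind_unit_inv (tsum_pure ind_unit_inv_bilinear) verma_trace1 ract1.
(* The composite is now the projection onto coinvariants, which fixes [t]. *)
apply: val_inj; rewrite /= -twisted_retract_ind.
exact: (twisted_retract_id (M := ind_ydmod N) (valP t)).
Qed.

End UnitInverse.

(** * Inverse of the counit, from a partial section of the canonical map *)

Section CounitInverse.
Variable s : {linear H -> tensor (coinv_rmod A) (coinv_lmod A)}.
Hypothesis sK : forall h, canonical_map (s h) = h \ox 1.

Section Inverse.
Variable M : ydmod A.

Definition coinv_part (m : M) (a : A) : coinv_mod M :=
  CoinvMod (twisted_retract_coinv m a).

Lemma coinv_part_linm a : linear (coinv_part^~ a).
Proof. by move=> c x y; apply: val_inj; apply: twisted_retract_linm. Qed.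
Lemma coinv_part_lina m : linear (coinv_part m).
Proof. by move=> c x y; apply: val_inj; apply: twisted_retract_lina. Qed.

(** Since [verma b] is [1 \ox b], [twisted_retract_verma] becomes right [B]-linearity. This is what
    makes the inverse of the counit balanced over [B]. *)
Lemma coinv_partM m a (b : B) :
  coinv_part m (a * coinv_val b) = coinv_act (coinv_part m a) b.
Proof.
apply: val_inj => /=.
have /coinvP hb := valP b; rewrite -(twisted_retract_verma gam_int) hb.
rewrite ktsum_pure //; split=> ?; first exact: twisted_retract_linh.
by apply: (lin_comp (twisted_retract_lina gam_int _ _)); lin.
Qed.

Lemma ind_counit_inv_bilinear m :
  @tbilinear k B (coinv_rmod A) (coinv_lmod A)
    (tensor (coinv_mod_rmod M) (coinv_lmod A))
    (fun a b : A => tpure (coinv_part m a : coinv_mod_rmod M) (b : coinv_lmod A)).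
Proof.
split=> [b|a|a r b].
- exact: (lin_purel (M := coinv_mod_rmod M) _ (coinv_part_lina m)).
- by apply: (lin_purer (N := coinv_lmod A)).
- by rewrite /= coinv_partM -tpure_bal.
Qed.

Definition ind_counit_inv (m : M) : tensor (coinv_mod_rmod M) (coinv_lmod A) :=
  \tsum_(h & n <- yd_coact m)
    tsum (s h) (fun a b : A =>
      tpure (coinv_part n a : coinv_mod_rmod M) (b : coinv_lmod A)).

Lemma ind_counit_inv_body_bilinear :
  kbilinear (fun (h : H) (n : M) => tsum (s h) (fun a b : A =>
      tpure (coinv_part n a : coinv_mod_rmod M) (b : coinv_lmod A))).
Proof.
split=> [n|h].
  by apply: (lin_comp (tsum_lin (ind_counit_inv_bilinear n))); lin.
(* The chosen representative of [s h] does not depend on [n], so linearity is checked term by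
   term. *)
move=> c x y; rewrite /tsum scaler_sumr -big_split; apply: eq_bigr => p _ /=.
exact: (lin_purel (M := coinv_mod_rmod M) _ (coinv_part_linm _)).
Qed.

Lemma ind_counit_inv_lin : linear ind_counit_inv.
Proof.
by case: ind_counit_inv_body_bilinear => ? ?; apply: lin_tsum_arg => //; lin.
Qed.

(** Both sides evaluate the twisted retraction on [canonical_map (s h)], which is [h \ox 1]. *)
Lemma twisted_retract_section (m : M) h :
  tsum (s h) (fun a b : A => ract (twisted_retract gam m 1 a) b) =
  coact_retract gam h m.
Proof.
rewrite -(twisted_retract_canonical gam_int) sK ktsum_pure.
  exact: twisted_retract1.
split=> ?; first exact: twisted_retract_linh.
exact: twisted_retract_lina.
Qed.

(** Letting [A] act turns the sum over [s h] into the retraction at [h], and the retraction undoes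
    the coaction. *)
Lemma ind_counit_invK m : ind_counit_map (ind_counit_inv m) = m.
Proof.
rewrite /ind_counit_inv (ktsum_comp _ (@ind_counit_lin _ _ _ M)).
rewrite -[RHS](coact_retractK gam_int gam_total).
apply: eq_ktsum => h n; rewrite (tsum_comp _ _ (@ind_counit_lin _ _ _ M)).
rewrite -twisted_retract_section; apply: eq_tsum => a b.
by rewrite ind_counit_pure.
Qed.

End Inverse.

(* For coinvariant m, [c |-> m c] is a morphism out of the Verma module, so
   [coinv_part (m c) a = m (coinv_part c a)], and the coinvariant
   [coinv_part c a] crosses the tensor product over B. *)
Lemma ind_counitK (M : ydmod A) t :
  ind_counit_inv (@ind_counit_map _ _ _ M t) = t.
Proof.
move: t; apply: tensor_linear_ext.
- exact: lin_comp (@ind_counit_inv_lin M) (@ind_counit_lin _ _ _ M).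
- exact: lin_id.
move=> m c; rewrite ind_counit_pure /ind_counit_inv.
rewrite coact_ract_coinv; last exact: valP.
rewrite tsum_tsum; last exact: ind_counit_inv_body_bilinear.
have lp : linear (fun x : A => tpure m (x : coinv_lmod A)).
  by apply: (lin_purer (N := coinv_lmod A)).
(* Expanding [c] by the retraction of the Verma module makes both sides sums over [verma c] and
   [s h], to be compared termwise. *)
rewrite -[in RHS](coact_retractK gam_int gam_total (M := verma_ydmod A) c).
rewrite [RHS](ktsum_comp _ lp); apply: eq_ktsum => h x.
rewrite ktsum_pure; last exact: ind_counit_inv_body_bilinear.
rewrite -twisted_retract_section [RHS](tsum_comp _ _ lp).
apply: eq_tsum => a b.
pose r : B := CoinvAlg (twisted_retract_coinv (M := verma_ydmod A) x a).
have -> : coinv_part (ract (m : M) x) a = coinv_act m r.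
  apply: val_inj; symmetry.
  exact: (twisted_retract_hom gam (orbit_hom (valP m)) x 1 a).
exact: (tpure_bal m r b).
Qed.

Lemma ind_counit_bij (M : ydmod A) : bijective (ind_counit_hom M).
Proof.
exists (@ind_counit_inv M); [exact: ind_counitK|exact: ind_counit_invK].
Qed.

End CounitInverse.

End Equivalence.

(** * Lifting through the canonical map, and the equivalence *)

Lemma canonical_section (k : comNzRingType) (H : bijHopfAlg k)
    (A : bicomodAlg H) :
  projective H ->
  (forall y : (H \otimes A)%type,
     exists t : tensor (coinv_rmod A) (coinv_lmod A), canonical_map t = y) ->
  exists s : {linear H -> tensor (coinv_rmod A) (coinv_lmod A)},
    forall h, canonical_map (s h) = h \ox 1.
Proof.
move=> H_proj H_surj.
pose p_lin := GRing.isLinear.Build k _ _ *:%R (@canonical_map k H A)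
  (tsum_lin (canonical_map_bilinear A)).
pose p : {linear tensor (coinv_rmod A) (coinv_lmod A) -> (H \otimes A)%type} :=
  HB.pack (@canonical_map k H A) p_lin.
have f_lin : linear (fun h : H => h \ox (1 : A)) by lin.
pose f_mix := GRing.isLinear.Build k _ _ *:%R (fun h : H => h \ox (1 : A)) f_lin.
pose f : {linear H -> (H \otimes A)%type} :=
  HB.pack (fun h : H => h \ox (1 : A)) f_mix.
exact: (H_proj _ _ p f H_surj).
Qed.

Theorem theorem4p15 (k : comNzRingType) (H : bijHopfAlg k) (A : bicomodAlg H)
    (H_proj : projective H)
    (H_int : exists gam : H -> {linear H -> A},
       quantum_integral gam /\ total_integral gam)
    (H_surj : forall y : (H \otimes A)%type,
       exists t : tensor (coinv_rmod A) (coinv_lmod A), canonical_map t = y) :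
  is_equivalence (induction_functor A).
Proof.
have [gam [gam_int gam_total]] := H_int.
have [s sK] := canonical_section H_proj H_surj.
(* The quasi-inverse takes coinvariants. *)
exists (coinv_functor A); split.
  apply: nat_iso_sym; exists (@ind_unit k H A); split=> [M N f|N].
    exact: ind_unit_nat.
  exact: rmod_bij_iso (ind_unit_bij gam_int gam_total N).
exists (@ind_counit_hom k H A); split=> [M N f|M].
  exact: ind_counit_nat.
exact: ydmod_bij_iso (ind_counit_bij gam_int gam_total sK M).
Qed.
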